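(* Consider the von Mises--Fisher families $\{\mathrm{MF}_d(\eta,\rho):\rho\ge0\}$, $\eta\in\mathbb{S}_d$. (a) If $d=1$ then $\beta(\rho)=e^\rho/I_0(\rho)-1$, the equation $\beta(\rho)=1$ has a unique finite positive solution $\rho_0\approx0.876842$, and for $0\le\rho\le\rho_0$ (and all $\eta\in\mathbb{S}_1$) it holds that $$\mathrm{MF}_1(\eta,\rho)=(1-\beta(\rho))\,\mathrm{unif}(\mathbb{S}_1)+\beta(\rho)\sum_{n=1}^\infty\mathrm{psk}(n|\rho)\,\Delta^0_{n,\eta}.$$ (b) If $d>1$ and $\lambda=(d-1)/2$ then $$\beta(\rho)=\beta_\lambda(\rho):=\frac{\rho^\lambda e^\rho}{2^\lambda\Gamma(\lambda+1)I_\lambda(\rho)}-1,$$ the equation $\beta_\lambda(\rho)=1$ has a unique finite positive solution $\rho_0(\lambda)$, and for $0\le\rho\le\rho_0(\lambda)$ (and all $\eta\in\mathbb{S}_d$) it holds that $$\mathrm{MF}_d(\eta,\rho)=(1-\beta_\lambda(\rho))\,\mathrm{unif}(\mathbb{S}_d)+\beta_\lambda(\rho)\sum_{n=1}^\infty\mathrm{gpsk}(n|\lambda,\rho)\,\Delta^\lambda_{n,\eta}.$$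
   Context: $\mathbb{S}_d=\{x\in\mathbb{R}^{d+1}:\|x\|=1\}$, $d\ge1$, with uniform distribution $\mathrm{unif}(\mathbb{S}_d)$; densities on $\mathbb{S}_d$ are with respect to it; $\lambda=(d-1)/2$; $\eta^{t}x$ is the Euclidean inner product; $(\alpha)_n=\Gamma(\alpha+n)/\Gamma(\alpha)$; $\mathbb{N}=\{1,2,\dots\}$. $I_\alpha(x)=\sum_{n=0}^\infty\frac{1}{n!\,\Gamma(n+\alpha+1)}(x/2)^{2n+\alpha}$ is the modified Bessel function of the first kind. $\mathrm{MF}_d(\eta,\rho)$, $\rho>0$, has density $x\mapsto\frac{\rho^\lambda}{2^\lambda\Gamma(\lambda+1)I_\lambda(\rho)}\exp(\rho\,\eta^{t}x)$; $\mathrm{MF}_d(\eta,0)=\mathrm{unif}(\mathbb{S}_d)$. $D_n^0=T_n$ (Chebyshev polynomial of the first kind), and for $\lambda>0$, $D_n^\lambda=C_n^\lambda/C_n^\lambda(1)$ with $C_n^\lambda$ the Gegenbauer (ultraspherical) polynomial of degree $n$, $C_n^\lambda(1)=(2\lambda)_n/n!$. For $n\in\mathbb{N}$, $\Delta^\lambda_{n,\eta}$ is the probability distribution on $\mathbb{S}_d$ with density $x\mapsto1+D_n^\lambda(\eta^{t}x)$. Definition of $\beta(\rho)$: if a family of distributions on $\mathbb{S}_d$ has densities $x\mapsto g_\rho(\eta^{t}x)$ and $\nu_d$ is the push-forward of $\mathrm{unif}(\mathbb{S}_d)$ under $x\mapsto\eta^{t}x$ (independent of $\eta$), then with $\langle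 f,g\rangle_\lambda=\int_{[-1,1]}fg\,d\nu_d$ and $\|f\|_\lambda^2=\langle f,f\rangle_\lambda$ one puts $\beta_n(\rho)=\langle g_\rho,D_n^\lambda\rangle_\lambda\|D_n^\lambda\|_\lambda^{-2}$, $n\in\mathbb{N}$, and $\beta(\rho)=\sum_{n=1}^\infty|\beta_n(\rho)|$. Positive Skellam mass function: $\mathrm{psk}(n|\rho)=\frac{2e^{-\rho}I_n(\rho)}{1-e^{-\rho}I_0(\rho)}$, $n\in\mathbb{N}$, $\rho>0$. Generalized positive Skellam mass function, $\kappa,\tau>0$: $$\mathrm{gpsk}(n|\kappa,\tau)=\Bigl(1+\frac n\kappa\Bigr)\frac{(2\kappa)_n}{n!}\,\frac{2^\kappa\Gamma(\kappa+1)\tau^{-\kappa}e^{-\tau}I_\kappa(\tau)}{1-2^\kappa\Gamma(\kappa+1)\tau^{-\kappa}e^{-\tau}I_\kappa(\tau)}\,\frac{I_{\kappa+n}(\tau)}{I_\kappa(\tau)},\quad n\in\mathbb{N}.$$ Convention at $\rho=0$: $\beta(0)$ and $\beta_\lambda(0)$ are $0$ (for $\beta_\lambda$ as the limit $\rho\downarrow0$) and the terms multiplied by them are taken to be $0$. *)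

(* Defs.v *)
(* MathComp-Analysis development. *)
From HB Require Import structures.
From mathcomp Require Import all_boot all_order all_algebra.
From mathcomp Require Import all_classical all_reals all_analysis.
From mathcomp Require Import measurable_realfun.

Set Implicit Arguments.
Unset Strict Implicit.
Unset Printing Implicit Defensive.

Import Order.TTheory GRing.Theory Num.Theory.
Import numFieldNormedType.Exports.

Local Open Scope classical_set_scope.
Local Open Scope ring_scope.

(* R^{d+1}. On tuples the library's sigma-algebra is the one generated by the
   coordinates, i.e. the Borel sigma-algebra. *)
Notation euclidean R d := ((d.+1).-tuple R).

Section sphere.
Context {R : realType} {d : nat}.
Implicit Types x y : euclidean R d.

Definition dot x y : R := \sum_(i < d.+1) tnth x i * tnth y i.

Definition on_sphere x : Prop := Num.sqrt (dot x x) = 1.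

Definition mxact (Q : 'M[R]_d.+1) x : euclidean R d :=
  [tuple \sum_(j < d.+1) Q i j * tnth x j | i < d.+1].

(* The uniform distribution on S_d is the unique Borel probability measure on
   S_d that is invariant under the orthogonal group O(d+1). Distributions on S_d
   are represented by measures on R^{d+1} carried by S_d. *)
Definition is_uniform_on_sphere (sigma : probability (euclidean R d) R) : Prop :=
  sigma [set x | on_sphere x] = 1%E /\
  forall Q : 'M[R]_d.+1, Q *m Q^T = 1%:M ->
    forall A : set (euclidean R d), measurable A ->
      sigma (mxact Q @^-1` A) = sigma A.

Lemma measurable_dot (eta : euclidean R d) :
  measurable_fun [set: euclidean R d] (dot eta).
Proof.
apply: measurable_sum => i; apply: measurable_funM; first exact: measurable_cst.
exact: measurable_tnth.
Qed.

HB.instance Definition _ (eta : euclidean R d) :=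
  isMeasurableFun.Build _ _ (euclidean R d) R (dot eta)
    (measurable_dot eta).

End sphere.

Section special_functions.
Context {R : realType}.
Implicit Types (a x t lam kappa tau rho : R) (n : nat).

(* Only used for x > 0, where the integral converges. *)
Definition Gamma x : R :=
  \int[@lebesgue_measure R]_(t in `]0, +oo[) (t `^ (x - 1) * expR (- t)).

Definition pochhammer a n : R := Gamma (a + n%:R) / Gamma a.

Definition besselI a x : R :=
  limn [series (n`!%:R * Gamma (n%:R + a + 1))^-1
               * (x / 2) `^ (2 * n%:R + a)]_n.

Fixpoint chebyshevT n : {poly R} :=
  match n with
  | 0 => 1
  | k.+1 => match k with
            | 0 => 'X
            | m.+1 => 2 *: 'X * chebyshevT k - chebyshevT m
            end
  end.

(* (n+2) C_{n+2} = 2 (n+1+lam) X C_{n+1} - (n + 2 lam) C_n *)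
Fixpoint gegenbauer lam n : {poly R} :=
  match n with
  | 0 => 1
  | k.+1 => match k with
            | 0 => (2 * lam) *: 'X
            | m.+1 => (m.+2%:R)^-1 *:
                ((2 * (m.+1%:R + lam)) *: 'X * gegenbauer lam k
                 - (m%:R + 2 * lam) *: gegenbauer lam m)
            end
  end.

Definition Dpoly lam n t : R :=
  if lam == 0 then (chebyshevT n).[t]
  else (gegenbauer lam n).[t] / (gegenbauer lam n).[1].

Definition psk n rho : R :=
  2 * expR (- rho) * besselI n%:R rho / (1 - expR (- rho) * besselI 0 rho).

Definition gpsk n kappa tau : R :=
  let q := 2 `^ kappa * Gamma (kappa + 1) * tau `^ (- kappa) * expR (- tau)
           * besselI kappa tau in
  (1 + n%:R / kappa) * (pochhammer (2 * kappa) n / n`!%:R) * (q / (1 - q))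
  * (besselI (kappa + n%:R) tau / besselI kappa tau).

(* The value at 0 is the limit as rho decreases to 0. *)
Definition beta_lam lam rho : R :=
  if rho == 0 then 0
  else rho `^ lam * expR rho / (2 `^ lam * Gamma (lam + 1) * besselI lam rho) - 1.

End special_functions.

Section distributions.
Context {R : realType} {d : nat}.
Variable sigma : probability (euclidean R d) R.
Implicit Types (eta : euclidean R d) (rho lam : R) (n : nat) (f g : R -> R)
  (A : set (euclidean R d)).

Definition lambda : R := (d%:R - 1) / 2.

Definition with_density (p : euclidean R d -> R) A : \bar R :=
  (\int[sigma]_(x in A) (p x)%:E)%E.

Definition nu eta : probability R R :=
  distribution sigma (dot eta : {mfun euclidean R d >-> R}).

Definition inner eta f g : R :=
  \int[nu eta]_(t in `[-1, 1]) (f t * g t).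

(* The coefficients beta_n and their absolute sum for the family of densities
   x |-> g (eta^t x). The sum is taken in the extended reals, so that equality
   with a finite number includes its convergence. *)
Definition beta_coef eta g n : R :=
  inner eta g (Dpoly lambda n) / inner eta (Dpoly lambda n) (Dpoly lambda n).

Definition beta eta g : \bar R :=
  (\sum_(1 <= n <oo) (`|beta_coef eta g n|)%:E)%E.

Definition mf_profile rho (t : R) : R :=
  if rho == 0 then 1
  else rho `^ lambda / (2 `^ lambda * Gamma (lambda + 1) * besselI lambda rho)
       * expR (rho * t).

Definition MF eta rho : set (euclidean R d) -> \bar R :=
  with_density (fun x => mf_profile rho (dot eta x)).

Definition Delta lam n eta : set (euclidean R d) -> \bar R :=
  with_density (fun x => 1 + Dpoly lam n (dot eta x)).

End distributions.

Arguments lambda R d : clear implicits.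
Arguments mf_profile {R} d rho t.

(* Main.v *)
(** Let t = eta^t x, D_n the normalized Gegenbauer (or Chebyshev) polynomials,
    and weight n = ||D_n||^-2. The three-term recurrence
    t D_n = up n D_{n+1} + down n D_{n-1} yields an explicit expansion
    t^k/k! = sum_n weight n * mcoef k n * D_n(t) with nonnegative coefficients;
    summing it against rho^k gives
      e^(rho t) = sum_n weight n * hcoef n rho * D_n(t),   uniformly on [-1, 1],
    where hcoef n rho is I_{lambda+n}(rho) up to the factor
    (rho/2)^lambda / Gamma(lambda+1). Rotation invariance determines the moments
    of t: comparing the coefficients of b^2 in
    E (e_0^t x + b e_j^t x)^(2k) = (1 + b^2)^k E t^(2k) gives a recurrence solved
    by E t^k = k! * mcoef k 0. Hence E D_n = 0 for n >= 1 by triangularity, and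
    the recurrence turns this into orthogonality (Favard). So
    beta_n = weight n * hcoef n / hcoef 0 >= 0, and t = 1 gives
    beta = e^rho / hcoef 0 - 1. Finally hcoef 0 rho / e^rho = E e^(-rho (1 - t))
    is strictly decreasing and continuous, from 1 to below 1/2. *)

(* The hypothesis on [sigma] is only that it is carried by the sphere and invariant, so no density
   for the law of [eta^t x] is at hand; every fact about that law is drawn from reflections
   exchanging two vectors of equal norm. Vectors of norm other than 1 have to be allowed there,
   because the moment identity varies the norm with [b]. The polynomials are rescaled to take the
   value 1 at 1. Their recurrence is then regular at [lambda = 0], where the Gegenbauer polynomials
   degenerate, so [d = 1] and [d > 1] share one argument and are told apart only when [weight] is
   matched with [psk] or [gpsk]. Working with the power series [hcoef] instead of [besselI] keeps
   real powers and [Gamma] out of the analysis; they enter through a single conversion lemma, which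
   in turn needs the functional equation of the [Gamma] integral. The equation [beta = 1] is studied
   through [1 / (beta + 1)], a mean of functions bounded by 1 whose monotonicity can be checked
   pointwise. The digits of the root for [d = 1] come from exact rational bounds on both sides of
   it. *)
Require Import Defs.
From mathcomp Require Import all_boot all_order all_algebra.
From mathcomp Require Import all_classical all_reals all_analysis.
From mathcomp Require Import measurable_realfun ring lra zify.

Set Implicit Arguments.
Unset Strict Implicit.
Unset Printing Implicit Defensive.

Import Order.TTheory GRing.Theory Num.Theory.
Import numFieldNormedType.Exports.

Local Open Scope classical_set_scope.
Local Open Scope ring_scope.

(** * The Gamma integral: functional equation and positivity *)

Section Gamma_function.
Context {R : realType}.
Implicit Types s t a K : R.
Notation mu := (@lebesgue_measure R).

(** The inequality [u <= e^u] at [u = t / (2 s)], raised to the power [s]. It provides an integrable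
    majorant for the Gamma integrand. *)
Lemma powR_le_expR s t : 0 <= s -> 0 <= t ->
  t `^ s <= (2 * s) `^ s * expR (t / 2).
Proof.
rewrite le_eqVlt => /predU1P[<- t0|s0 t0].
  by rewrite !powRr0 mul1r; apply: le_trans (expR_ge1Dx _); lra.
have s20 : 0 < 2 * s by lra.
have s20' := ltW s20.
have -> : t `^ s = (2 * s) `^ s * (t / (2 * s)) `^ s.
  rewrite -powRM ?divr_ge0//; congr (powR _ s).
  by rewrite mulrC divfK// gt_eqF.
have -> : t / 2 = t / (2 * s) * s by field; rewrite gt_eqF.
rewrite expRM ler_wpM2l ?powR_ge0// ge0_ler_powR ?nnegrE ?expR_ge0 ?divr_ge0//.
  exact: ltW.
by apply: le_trans (expR_ge1Dx _); lra.
Qed.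

Lemma powR_expRN_le s t : 0 <= s -> 0 <= t ->
  t `^ s * expR (- t) <= (2 * s) `^ s * expR (- (1 / 2) * t).
Proof.
move=> s0 t0; apply: (@le_trans _ _ ((2 * s) `^ s * expR (t / 2) * expR (- t))).
  by rewrite ler_wpM2r ?expR_ge0// powR_le_expR.
by rewrite -mulrA -expRD ler_wpM2l ?powR_ge0// ler_expR; lra.
Qed.

Lemma continuous_expRM a : continuous (fun t : R => expR (a * t)).
Proof.
move=> t; apply: (@continuous_comp _ _ _ (fun t => a * t) expR);
  [exact: mulrl_continuous|exact: continuous_expR].
Qed.

Lemma continuous_expRN : continuous (fun t : R => expR (- t)).
Proof.
have -> : (fun t => expR (- t)) = (fun t : R => expR (-1 * t)).
  by apply: funext => t; rewrite mulN1r.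
exact: continuous_expRM.
Qed.

Lemma powR_cvg_at0 s : 0 <= s -> t `^ s @[t --> 0^'+] --> (0 : R) `^ s.
Proof.
rewrite le_eqVlt => /predU1P[<-|s0].
  by under eq_cvg do rewrite powRr0; rewrite powRr0; exact: cvg_cst.
by rewrite (powR0 (lt0r_neq0 s0)); exact: powR_cvg0.
Qed.

Lemma continuous_powR s t : 0 < t -> {for t, continuous (fun t => t `^ s)}.
Proof.
move=> t0; apply/differentiable_continuous/derivable1_diffP/derivable_powR.
by rewrite in_itv/= t0.
Qed.

Lemma is_derive_powR s t : 0 < t ->
  is_derive t 1 (fun t => t `^ s) (s * t `^ (s - 1)).
Proof.
move=> t0; have tI : t \in `]0, +oo[ by rewrite in_itv/= t0.
apply: DeriveDef; first exact: derivable_powR.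
by rewrite -derive1E powR_derive1.
Qed.

Lemma is_derive_expRM a t :
  is_derive t 1 (fun t : R => expR (a * t)) (a * expR (a * t)).
Proof.
have -> : (fun t : R => expR (a * t)) = expR \o ( *%R a) by [].
by apply: is_derive_eq; rewrite !scaler1 -[LHS]/(_ * _) mulrC.
Qed.

Lemma is_derive_expRN t :
  is_derive t 1 (fun t : R => expR (- t)) (- expR (- t)).
Proof.
have -> : (fun t => expR (- t)) = (fun t : R => expR (-1 * t)).
  by apply: funext => u; rewrite mulN1r.
by have := is_derive_expRM (-1) t; rewrite !mulN1r.
Qed.

Lemma expRM_cvg0 a : a < 0 -> expR (a * t) @[t --> +oo] --> (0 : R).
Proof.
move=> a0.
have -> : (fun t => expR (a * t)) = (fun z => expR (- z)) \o (fun z => (- a) * z).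
  by apply: funext => t /=; rewrite mulNr opprK.
apply: (@cvg_comp _ _ _ _ _ _ (pinfty_nbhs R)); last exact: cvgr_expR.
by apply: gt0_cvgMry; rewrite ?oppr_gt0//; exact: cvg_id.
Qed.

Lemma measurable_powR_expRN s (D : set R) :
  measurable_fun D (fun t => t `^ s * expR (- t)).
Proof.
apply: measurable_funTS; apply: measurable_funM; first exact: measurable_powR.
by apply: measurableT_comp; [exact: measurable_expR|exact: measurable_funN].
Qed.

Lemma integral_expRM K a : 0 <= K -> a < 0 ->
  (\int[mu]_(t in `[0%R, +oo[) (K * expR (a * t))%:E = (- (K / a))%:E)%E.
Proof.
move=> K0 a0.
rewrite (@ge0_continuous_FTC2y _ _ (fun t => K / a * expR (a * t)) _ 0).
- by rewrite mulr0 expR0 mulr1 sub0e.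
- by move=> t _; rewrite mulr_ge0 ?expR_ge0.
- apply: continuous_subspaceT => t; apply: cvgM; first exact: cvg_cst.
  exact: continuous_expRM.
- rewrite -[X in _ --> X](mulr0 (K / a)); apply: cvgM; first exact: cvg_cst.
  exact: expRM_cvg0.
- by move=> t _; apply: derivableM => //; have [] := is_derive_expRM a t.
- apply: cvg_at_right_filter; apply: cvgM; first exact: cvg_cst.
  exact: continuous_expRM.
- move=> t _; rewrite derive1E; have := is_derive_expRM a t => H.
  rewrite derive_val -[LHS]/(_ * _) mulrA divfK//.
  by rewrite lt_eqF.
Qed.

Lemma integrable_expRM K a : 0 <= K -> a < 0 ->
  mu.-integrable `[0%R, +oo[ (EFin \o (fun t => K * expR (a * t))).
Proof.
move=> K0 a0; apply/integrableP; split.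
  apply/measurable_EFinP/measurable_funTS/measurable_funM => //.
  apply: measurableT_comp; [exact: measurable_expR|exact: measurable_funM].
under eq_integral do rewrite /= ger0_norm ?mulr_ge0 ?expR_ge0//.
by rewrite integral_expRM// ltry.
Qed.

Lemma integrable_powR_expRN s : 0 <= s ->
  mu.-integrable `[0%R, +oo[ (EFin \o (fun t => t `^ s * expR (- t))).
Proof.
move=> s0; have n0 : - (1 / 2) < 0 :> R by lra.
apply: le_integrable (integrable_expRM (powR_ge0 (2 * s) s) n0) => //.
- apply/measurable_EFinP; exact: measurable_powR_expRN.
- move=> t; rewrite /= in_itv/= andbT => t0.
  by rewrite lee_fin !ger0_norm ?mulr_ge0 ?powR_ge0 ?expR_ge0// powR_expRN_le.
Qed.

Lemma GammaE a : Gamma a = \int[mu]_(t in `[0, +oo[) (t `^ (a - 1) * expR (- t)).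
Proof.
rewrite /Gamma /Rintegral integral_itv_obnd_cbnd//.
by apply/measurable_EFinP; exact: measurable_powR_expRN.
Qed.

(** Integration by parts on [[0, +oo[]. The restriction [1 <= a] keeps [t^(a-1)] continuous at 0;
    the arguments that occur, [lambda + 1 + n] and [2 lambda + n] with [2 lambda >= 1], all satisfy
    it. *)
Lemma GammaD1 a : 1 <= a -> Gamma (a + 1) = a * Gamma a.
Proof.
move=> a1; have s0 : 0 <= a - 1 by lra.
have a0 : 0 <= a by lra.
have aN0 : a != 0 by apply: lt0r_neq0; lra.
have n0 : - (1 / 2) < 0 :> R by lra.
have E3 (x y z : R) : x + (z - y) = z -> y = x by lra.
have E2 (x : R) : - (x / - (1 / 2)) = - (- 2 * x) by field.
have E4 (x y z e1 e2 : R) :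
    x * - e1 + e1 * (a * y) + - 2 * z * (- (1 / 2) * e2)
    = a * (y * e1) + (z * e2 - x * e1) by field.
rewrite !GammaE addrK -RintegralZl//; last exact: integrable_powR_expRN.
pose g t : R := a * (t `^ (a - 1) * expR (- t)).
pose h t : R := t `^ a * expR (- t).
pose K := (2 * a) `^ a; pose k t : R := K * expR (- (1 / 2) * t).
have K0 : 0 <= K by exact: powR_ge0.
have ig : mu.-integrable `[0%R, +oo[ (EFin \o g).
  have -> : EFin \o g = (fun t => a%:E * (t `^ (a - 1) * expR (- t))%:E)%E.
    by apply: funext => t /=; rewrite -EFinM.
  by apply: integrableZl => //; exact: integrable_powR_expRN.
have ih : mu.-integrable `[0%R, +oo[ (EFin \o h) by exact: integrable_powR_expRN.
have ik : mu.-integrable `[0%R, +oo[ (EFin \o k) by apply: integrable_expRM.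
have ihk : mu.-integrable `[0%R, +oo[ (EFin \o (fun t => k t - h t)).
  have -> : EFin \o (fun t => k t - h t) = ((EFin \o k) \- (EFin \o h))%E by [].
  exact: integrableB.
(* [g - h] is the derivative of [t^a e^-t]; adding [k >= h] makes the integrand
   nonnegative, as the fundamental theorem on [0, +oo[ requires. *)
suff : \int[mu]_(t in `[0, +oo[) (g t + (k t - h t))
       = \int[mu]_(t in `[0, +oo[) k t.
  rewrite RintegralD// RintegralB// => H; rewrite -[LHS]/(\int[mu]_(t in `[0, +oo[) h t).
  by rewrite -[RHS]/(\int[mu]_(t in `[0, +oo[) g t); exact: E3 H.
rewrite /Rintegral integral_expRM//.
rewrite (@ge0_continuous_FTC2y _ _
  (fun t => t `^ a * expR (- t) + (- 2 * K) * expR (- (1 / 2) * t)) _ 0).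
- by rewrite mulr0 expR0 powR0// mul0r !add0r mulr1 E2.
- move=> t t0; apply: addr_ge0.
    by rewrite /g !mulr_ge0 ?powR_ge0 ?expR_ge0.
  by rewrite subr_ge0; exact: powR_expRN_le.
(* A general filter covers both the interior points and the right-hand limit at 0. *)
- have cg F : Filter F -> forall t : R, expR (- x) @[x --> F] --> expR (- t) ->
     expR (- (1/2) * x) @[x --> F] --> expR (- (1/2) * t) ->
     x `^ (a - 1) @[x --> F] --> t `^ (a - 1) -> x `^ a @[x --> F] --> t `^ a ->
     g x + (k x - h x) @[x --> F] --> g t + (k t - h t).
    move=> FF t c1 c2 c3 c4.
    apply: cvgD; first by apply: cvgM; [exact: cvg_cst|exact: cvgM].
    by apply: cvgB; apply: cvgM => //; exact: cvg_cst.
  apply/continuous_within_itvcyP; split.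
    move=> t; rewrite in_itv/= andbT => t0.
    by apply: cg; [exact: continuous_expRN|exact: continuous_expRM|exact: continuous_powR..].
  by apply: cg; [exact/cvg_at_right_filter/continuous_expRN
    |exact/cvg_at_right_filter/continuous_expRM|exact: powR_cvg_at0..].
- rewrite -[X in _ --> X](addr0 0); apply: cvgD; last first.
    rewrite -[X in _ --> X](mulr0 (- 2 * K)); apply: cvgM; first exact: cvg_cst.
    exact: expRM_cvg0.
  apply: (@squeeze_cvgr _ _ _ _ (cst 0) k); last 2 first.
  + exact: cvg_cst.
  + rewrite -[X in _ --> X](mulr0 K); apply: cvgM; first exact: cvg_cst.
    exact: expRM_cvg0.
  near=> t; rewrite /cst mulr_ge0 ?powR_ge0 ?expR_ge0//=.
  by apply: powR_expRN_le => //; near: t; exact: nbhs_pinfty_ge.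
- move=> t t0; apply: derivableD.
    apply: derivableM; first by have [] := is_derive_powR a t0.
    by have [] := is_derive_expRN t.
  by apply: derivableM => //; have [] := is_derive_expRM (- (1 / 2)) t.
- apply: cvgD.
    apply: cvgM; first exact: powR_cvg_at0.
    by apply: cvg_at_right_filter; exact: continuous_expRN.
  by apply: cvg_at_right_filter; apply: cvgM;
    [exact: cvg_cst|exact: continuous_expRM].
- move=> t; rewrite in_itv/= andbT => t0; rewrite derive1E.
  have H1 := is_derive_powR a t0.
  have H2 := is_derive_expRN t.
  have H3 := is_derive_expRM (- (1 / 2)) t.
  rewrite derive_val; exact: E4.
Unshelve. all: by end_near. Qed.

Lemma Gamma1 : Gamma (1 : R) = 1.
Proof.
rewrite GammaE subrr.
under eq_Rintegral do rewrite powRr0 -mulN1r.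
by rewrite /Rintegral integral_expRM ?ltrN10// invrN1 mulrN1 opprK.
Qed.

(** On [[1, 2]] the integrand is at least [e^-2], and it is nonnegative elsewhere. *)
Lemma Gamma_gt0 a : 1 <= a -> 0 < Gamma a.
Proof.
move=> a1; have s0 : 0 <= a - 1 by lra.
have m12 : mu `[1%R, 2%R]%classic = 1%E.
  by rewrite lebesgue_measure_itv/= lte_fin ltr1n/= -EFinB; congr EFin; lra.
rewrite GammaE; apply: (@lt_le_trans _ _ (\int[mu]_(t in `[1, 2]) (expR (- 2)))).
  rewrite Rintegral_cst// [fine _](congr1 fine m12) mulr_gt0 ?expR_gt0//; lra.
have sub : [set` `[1 : R, 2 : R]] `<=` [set` `[0 : R, +oo[].
  by move=> t /=; rewrite !in_itv/=; lra.
have ig := integrable_powR_expRN s0.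
have ig' : mu.-integrable `[1%R, 2%R]
    (EFin \o (fun t => t `^ (a - 1) * expR (- t))).
  by apply: integrableS ig.
apply: (@le_trans _ _ (\int[mu]_(t in `[1, 2]) (t `^ (a - 1) * expR (- t)))).
  apply: le_Rintegral => //.
    apply: measurable_bounded_integrable => //.
      by rewrite [X in (X < _)%E]m12 ltry.
    by exists (expR (-2)); split => // x Hx t _; rewrite ger0_norm ?expR_ge0 ?ltW.
  move=> t; rewrite /= in_itv/= => /andP[t1 t2]; have t0 : 0 <= t := le_trans ler01 t1.
  rewrite -[leLHS]mul1r ler_pM ?expR_ge0//; last by rewrite ler_expR; lra.
  rewrite -[leLHS](congr1 (@^~ (a - 1)) (@powR1 R)) ge0_ler_powR ?nnegrE//.
apply: fine_le; [exact: integrable_fin_num|exact: integrable_fin_num|].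
apply: ge0_subset_integral => //.
  by apply/measurable_EFinP; exact: measurable_powR_expRN.
by move=> t _; rewrite lee_fin mulr_ge0 ?powR_ge0 ?expR_ge0.
Qed.
End Gamma_function.

(** * Normalized Gegenbauer polynomials and the expansion of monomials *)

Section polynomials.
Context {R : realType}.
Variable l : R.
Implicit Types (t rho : R) (n k j K N : nat).

(** The Gegenbauer recurrence after division by the value at 1. At [l = 0] it reads
    [D_(n+2) = 2 t D_(n+1) - D_n], the Chebyshev recurrence. *)
Fixpoint Dfun n t : R :=
  match n with
  | 0 => 1
  | k.+1 => match k with
            | 0 => t
            | m.+1 => (2 * (m.+1%:R + l) * t * Dfun k t - m.+1%:R * Dfun m t)
                      / (m.+1%:R + 2 * l)
            end
  end.

(* The case [n = 0] is separate because the quotient is [0 / 0] when [l = 0]. *)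
Definition up n : R := if n is 0 then 1 else (n%:R + 2 * l) / (2 * (n%:R + l)).

Definition down n : R := n%:R / (2 * (n%:R + l)).

(** Chosen so that [weight n.+1 * down n.+1 = weight n * up n], the relation that symmetrizes the
    three-term recurrence. *)
Definition weight n : R := \prod_(i < n) (up i / down i.+1).

(** The Pochhammer symbol [(l+1)_n] as a finite product, free of [Gamma]. *)
Definition rising n : R := \prod_(i < n) (l + 1 + i%:R).

(** The coefficient of [rho^(n+2j)] in [Gamma(l+1) (rho/2)^(-l) I_(l+n)(rho)]. The next but one
    lists the same numbers by the exponent [k = n + 2j], with 0 at the other exponents. *)
Definition bcoef j n : R := (2 ^+ (n + j.*2) * (j`!%:R * rising (n + j)))^-1.

Definition mcoef k n : R :=
  if (n <= k)%N && ~~ odd (k - n) then bcoef (k - n)./2 n else 0.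

Lemma DfunSS n t : Dfun n.+2 t =
  (2 * (n.+1%:R + l) * t * Dfun n.+1 t - n.+1%:R * Dfun n t) / (n.+1%:R + 2 * l).
Proof. by []. Qed.

Lemma up_gt0 n (l0 : 0 <= l) : 0 < up n.
Proof.
case: n => [|n] //=; rewrite -[n.+1%:R]natr1; have := ler0n R n => n0.
by apply: divr_gt0; lra.
Qed.

Lemma down_gt0 n (l0 : 0 <= l) : 0 < down n.+1.
Proof. by rewrite /down -[n.+1%:R]natr1; have := ler0n R n => n0; apply: divr_gt0; lra. Qed.

Lemma weightS n (l0 : 0 <= l) : weight n.+1 * down n.+1 = weight n * up n.
Proof. by rewrite /weight big_ord_recr/= mulrA divfK// gt_eqF ?down_gt0. Qed.

Lemma weight0 : weight 0 = 1.
Proof. by rewrite /weight big_ord0. Qed.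

Lemma weight_gt0 n (l0 : 0 <= l) : 0 < weight n.
Proof. by rewrite /weight prodr_gt0// => i _; rewrite divr_gt0 ?up_gt0 ?down_gt0. Qed.

Lemma risingS n : rising n.+1 = rising n * (l + 1 + n%:R).
Proof. by rewrite /rising big_ord_recr. Qed.

Lemma rising_gt0 n (l0 : 0 <= l) : 0 < rising n.
Proof. by rewrite /rising prodr_gt0// => i _; have := ler0n R i; lra. Qed.

Lemma bcoef_gt0 j n (l0 : 0 <= l) : 0 < bcoef j n.
Proof. by rewrite invr_gt0 !mulr_gt0 ?exprn_gt0 ?rising_gt0 ?ltr0n ?fact_gt0. Qed.

Lemma mcoef_ge0 k n (l0 : 0 <= l) : 0 <= mcoef k n.
Proof. by rewrite /mcoef; case: ifP => // _; exact/ltW/(bcoef_gt0 _ _ l0). Qed.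

Lemma mcoef_bcoef j n : mcoef (n + j.*2) n = bcoef j n.
Proof. by rewrite /mcoef leq_addr addKn odd_double doubleK. Qed.

Lemma mcoef_odd j n : mcoef (n + j.*2).+1 n = 0.
Proof. by rewrite /mcoef -addnS addKn /= odd_double andbF. Qed.

Lemma mcoef_small k n : (k < n)%N -> mcoef k n = 0.
Proof. by move=> kn; rewrite /mcoef leqNgt kn. Qed.

Variant mcoef_spec k n : Prop :=
| McoefSmall of (k < n)%N
| McoefEven j of k = (n + j.*2)%N
| McoefOdd j of k = (n + j.*2).+1.

Lemma mcoefP k n : mcoef_spec k n.
Proof.
have [/McoefSmall//|nk] := ltnP k n.
have [kn|kn] := boolP (odd (k - n)).
  by apply: (@McoefOdd _ _ (k - n)./2); have := odd_double_half (k - n); lia.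
by apply: (@McoefEven _ _ (k - n)./2); have := odd_double_half (k - n); lia.
Qed.

Lemma mcoef_rec0 k (l0 : 0 <= l) : k.+1%:R * mcoef k.+1 0 = mcoef k 1.
Proof.
case: (mcoefP k 1) => [|j ->|j ->].
- by case: k => // _; rewrite (mcoef_odd 0 0) mcoef_small// mulr0.
- rewrite mcoef_bcoef.
  have -> : (1 + j.*2).+1 = (0 + j.+1.*2)%N by lia.
  rewrite mcoef_bcoef /bcoef !add0n add1n risingS factS natrM.
  have -> : (j.+1.*2 = (1 + j.*2).+1)%N by lia.
  rewrite exprS -[X in X * _ = _]natr1 natrD -mul2n natrM -[j.+1%:R]natr1.
  have := ler0n R j => jj; have := rising_gt0 j l0 => r0.
  have f0 : j`!%:R != 0 :> R by rewrite pnatr_eq0 -lt0n fact_gt0.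
  field; rewrite ?expf_neq0//=; repeat (apply/andP; split) => //; lra.
- rewrite mcoef_odd; have -> : (1 + j.*2).+2 = (0 + j.+1.*2).+1 by lia.
  by rewrite mcoef_odd mulr0.
Qed.

(** Coefficient form of [h_(n+1)' = down n.+1 * h_n + up n.+1 * h_(n+2)] for the generating series
    [h_n] of [mcoef k n], which is the derivative formula for Bessel functions. *)
Lemma mcoef_recS k n (l0 : 0 <= l) :
  k.+1%:R * mcoef k.+1 n.+1 = down n.+1 * mcoef k n + up n.+1 * mcoef k n.+2.
Proof.
case: (mcoefP k n) => [kn|j ->|j ->].
- by rewrite !mcoef_small ?mulr0 ?addr0//; lia.
- rewrite mcoef_bcoef -addSn mcoef_bcoef.
  case: j => [|j].
    rewrite [mcoef _ n.+2]mcoef_small; last by rewrite addn0; lia.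
    rewrite /bcoef /down double0 !addn0 risingS exprS -![n.+1%:R]natr1.
    have := ler0n R n => nn; have := rising_gt0 n l0 => r0.
    field; rewrite ?expf_neq0//=; repeat (apply/andP; split) => //; lra.
  have -> : (n + j.+1.*2 = n.+2 + j.*2)%N by lia.
  rewrite mcoef_bcoef /bcoef /down /up.
  have -> : (n.+1 + j.+1 = (n + j.+1).+1)%N by lia.
  have -> : (n.+2 + j = (n + j.+1).+1)%N by lia.
  have -> : (n.+1 + j.+1.*2 = (n.+2 + j.*2).+1)%N by lia.
  have -> : (n + j.+1.*2 = n.+2 + j.*2)%N by lia.
  rewrite risingS exprS factS natrM.
  have -> : (n + j.+1 = n + j + 1)%N by lia.
  rewrite -[(n.+2 + j.*2).+1%:R]natr1 !natrD -mul2n natrM.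
  rewrite -![n.+2%:R]natr1 -![n.+1%:R]natr1 -![j.+1%:R]natr1.
  have := ler0n R n => nn; have := rising_gt0 (n + j + 1) l0 => r0.
  have := ler0n R j => jj.
  have f0 : j`!%:R != 0 :> R by rewrite pnatr_eq0 -lt0n fact_gt0.
  field; rewrite ?expf_neq0//=; repeat (apply/andP; split) => //; lra.
- rewrite mcoef_odd; case: j => [|j].
    rewrite [mcoef _ n.+2]mcoef_small; last by rewrite addn0; lia.
    by rewrite (mcoef_odd 0 n.+1) !mulr0 addr0.
  have -> : (n + j.+1.*2).+2 = (n.+1 + j.+1.*2).+1 by lia.
  have -> : (n + j.+1.*2).+1 = (n.+2 + j.*2).+1 by lia.
  by rewrite !mcoef_odd !mulr0 addr0.
Qed.

(* At [n = 0] the junk index [n.-1] is harmless: [down 0 = 0]. *)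
Lemma DfunX n t (l0 : 0 <= l) : t * Dfun n t = up n * Dfun n.+1 t + down n * Dfun n.-1 t.
Proof.
case: n => [|n]; first by rewrite /down !mul0r /= mul1r mulr1 addr0.
rewrite DfunSS /down /= -[n.+1%:R]natr1; have := ler0n R n => n0.
by field; repeat (apply/andP; split); lra.
Qed.

Lemma Dfun1 n (l0 : 0 <= l) : Dfun n 1 = 1.
Proof.
elim/ltn_ind: n => -[|[|n]] // IH; rewrite DfunSS !IH// -[n.+1%:R]natr1.
by have := ler0n R n => n0; field; lra.
Qed.

(** A crude substitute for the sharp bound 1: the induction closes because
    [2 (m + l) * 3 + m <= 9 (m + 2 l)]. *)
Lemma Dfun_bound n t (l0 : 0 <= l) : `|t| <= 1 -> `|Dfun n t| <= 3 ^+ n.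
Proof.
move=> t1; elim/ltn_ind: n => -[|[|n]] IH; first by rewrite normr1.
  by rewrite expr1 /=; apply: le_trans t1 _; lra.
have n0 := ler0n R n; rewrite DfunSS normrM normfV.
have d0 : 0 < n.+1%:R + 2 * l by rewrite -[n.+1%:R]natr1; lra.
rewrite [X in _ / X]gtr0_norm// ler_pdivrMr//.
have := IH n (leqnSn _); have := IH n.+1 (leqnn _).
set x := Dfun n.+1 t; set y := Dfun n t; rewrite !exprS.
have : 0 <= 3 ^+ n :> R by rewrite exprn_ge0.
move: (3 ^+ n) => c c0 hx hy.
apply: (le_trans (ler_normB _ _)); rewrite !normrM [`|2|]ger0_norm// [`|n.+1%:R|]ger0_norm//.
rewrite [`|n.+1%:R + l|]ger0_norm; last by rewrite -[n.+1%:R]natr1; lra.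
have tx : `|t| * `|x| <= 3 * c by rewrite -[leRHS]mul1r ler_pM.
have m0 : 0 <= n.+1%:R :> R by [].
move: (n.+1%:R : R) m0 d0 => m m0 d0.
have h1 : (m + l) * (`|t| * `|x|) <= (m + l) * (3 * c) by rewrite ler_wpM2l//; lra.
have h2 : m * `|y| <= m * c by rewrite ler_wpM2l.
have h3 : 0 <= m * c by rewrite mulr_ge0.
have h4 : 0 <= l * c by rewrite mulr_ge0.
lra.
Qed.

(** Induction on [k]: multiply by [t], apply [DfunX] to each term and regroup by polynomial.
    [weightS] converts the weights of both neighbours into the weight of the target, after which
    [mcoef_recS] applies. The free bound [N] absorbs the index shifts, as the terms beyond [k]
    vanish. *)
Lemma monomial_expansion k N t (l0 : 0 <= l) : (k < N)%N ->
  t ^+ k / k`!%:R = \sum_(n < N) weight n * mcoef k n * Dfun n t.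
Proof.
elim: k N => [|k IH] [//|N] kN.
  rewrite big_ord_recl big1 ?addr0 => [|i _]; last first.
    by rewrite mcoef_small// mulr0 mul0r.
  by rewrite weight0 (mcoef_bcoef 0 0) /bcoef /rising big_ord0 expr0 !mul1r fact0 /= mulr1.
have k0 : k.+1%:R != 0 :> R by rewrite pnatr_eq0.
apply: (mulfI k0).
transitivity (t * (t ^+ k / k`!%:R)).
  rewrite factS natrM exprS.
  have f0 : k`!%:R != 0 :> R by rewrite pnatr_eq0 -lt0n fact_gt0.
  move: (k.+1%:R : R) k0 (k`!%:R : R) f0 => a a0 b b0.
  by field; rewrite a0 b0.
rewrite (IH N kN) mulr_sumr.
case: N kN => [//|N] kN.
transitivity (\sum_(n < N.+1) weight n * mcoef k n * up n * Dfun n.+1 t +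
   \sum_(n < N) weight n.+1 * mcoef k n.+1 * down n.+1 * Dfun n t).
  transitivity (\sum_(n < N.+1) (weight n * mcoef k n * up n * Dfun n.+1 t +
    weight n * mcoef k n * down n * Dfun n.-1 t)).
    by apply: eq_bigr => n _; rewrite mulrCA DfunX//; ring.
  rewrite big_split; congr (_ + _).
  by rewrite big_ord_recl {1}/down /= mul0r mulr0 mul0r add0r.
(* Two vanishing terms are appended to the second sum, so that once its first term is split off both
   sums have the same range. *)
transitivity (\sum_(n < N.+1) weight n * mcoef k n * up n * Dfun n.+1 t +
   \sum_(n < N.+2) weight n.+1 * mcoef k n.+1 * down n.+1 * Dfun n t).
  rewrite !big_ord_recr/= [mcoef k N.+1]mcoef_small// [mcoef k N.+2]mcoef_small; last by lia.
  by rewrite !mulr0 !mul0r !addr0.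
rewrite [X in _ + X]big_ord_recl [in RHS]big_ord_recl mulrDr addrCA mulr_sumr.
congr (_ + _).
  rewrite weight0 mul1r /= !mulr1 (mcoef_rec0 _ l0).
  by rewrite mulrAC weightS// weight0 /= !mul1r.
rewrite -big_split; apply: eq_bigr => n _.
rewrite (_ : nat_of_ord (lift ord0 n) = n.+1)//.
have -> : k.+1%:R * (weight n.+1 * mcoef k.+1 n.+1 * Dfun n.+1 t) =
  weight n.+1 * (k.+1%:R * mcoef k.+1 n.+1) * Dfun n.+1 t by ring.
rewrite mcoef_recS//.
have w1 := weightS n l0; have w2 := weightS n.+1 l0.
transitivity ((weight n * up n) * mcoef k n * Dfun n.+1 t +
  (weight n.+2 * down n.+2) * mcoef k n.+2 * Dfun n.+1 t).
  by rewrite /= -![Algebra.Algebra_add__canonical__Monoid_ComLaw _ _ _]/(_ + _); ring.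
by rewrite -w1 w2; ring.
Qed.

Lemma sum_weight_mcoef k N (l0 : 0 <= l) : (k < N)%N ->
  \sum_(n < N) weight n * mcoef k n = k`!%:R^-1.
Proof.
move=> kN; have := monomial_expansion 1 l0 kN; rewrite expr1n mul1r => ->.
by apply: eq_bigr => n _; rewrite Dfun1// mulr1.
Qed.

End polynomials.

(** * Uniform expansion of the exponential and its link with Bessel functions *)

Section exponential_expansion.
Context {R : realType}.
Variable l : R.
Implicit Types (t rho : R) (n k j K N : nat).

Definition exp_tail rho N := expR rho - series (exp_coeff rho) N.

Definition hcoef n rho : R := limn (series (fun k => mcoef l k n * rho ^+ k)).

Lemma cvg_ord_sum N (u : nat -> nat -> R) (v : nat -> R) :
  (forall n, u n x @[x --> \oo] --> v n) ->
  \sum_(n < N) u n x @[x --> \oo] --> \sum_(n < N) v n.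
Proof.
move=> uv; elim: N => [|N IH].
  by rewrite big_ord0; under eq_cvg do rewrite big_ord0; exact: cvg_cst.
rewrite big_ord_recr; under eq_cvg do rewrite big_ord_recr.
exact: cvgD.
Qed.

Lemma cvg_exp_series rho : series (exp_coeff rho) x @[x --> \oo] --> expR rho.
Proof. exact: is_cvg_series_exp_coeff. Qed.

Lemma exp_tail_cvg0 rho : exp_tail rho x @[x --> \oo] --> (0 : R).
Proof.
rewrite /exp_tail -[X in _ --> X](subrr (expR rho)).
by apply: cvgB; [exact: cvg_cst|exact: cvg_exp_series].
Qed.

(** A single term of the nonnegative sum obtained from the monomial expansion at [t = 1]. It lets
    the exponential series dominate every [hcoef]. *)
Lemma weight_mcoef_le k n (l0 : 0 <= l) : weight l n * mcoef l k n <= k`!%:R^-1.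
Proof.
have [kn|nk] := ltnP k n; first by rewrite mcoef_small// mulr0 invr_ge0.
rewrite -(@sum_weight_mcoef _ l k k.+1 l0 (ltnSn k)).
rewrite (bigD1 (Ordinal (nk : (n < k.+1)%N)))//= lerDl sumr_ge0// => i _.
by rewrite mulr_ge0 ?mcoef_ge0// ltW// weight_gt0.
Qed.

Lemma cvg_hcoef n rho : 0 <= l -> 0 <= rho ->
  series (fun k => mcoef l k n * rho ^+ k) x @[x --> \oo] --> hcoef n rho.
Proof.
move=> l0 rho0; have w0 := weight_gt0 n l0.
suff : cvgn (series (fun k => mcoef l k n * rho ^+ k)) by [].
apply: (@series_le_cvg _ _ ((weight l n)^-1 *: exp_coeff rho)).
- by move=> k /=; rewrite mulr_ge0 ?mcoef_ge0 ?exprn_ge0.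
- by move=> k; apply: mulr_ge0; [rewrite ltW ?invr_gt0|rewrite divr_ge0 ?exprn_ge0].
- move=> k; rewrite -[leRHS]/(_ * (_ / _)) ler_pdivlMl// mulrA mulrC.
  by rewrite ler_wpM2l ?exprn_ge0 ?weight_mcoef_le.
- by apply: is_cvg_seriesZ; exact: is_cvg_series_exp_coeff.
Qed.

(* The crude bound [|D_n| <= 3^n] suffices, since only monomials of degree at
   least [n] contribute to the coefficient of [D_n]. *)
Lemma expansion_partial_le rho t N K : 0 <= l -> 0 <= rho -> `|t| <= 1 ->
  (N <= K)%N ->
  `|series (exp_coeff (rho * t)) K - \sum_(n < N) weight l n *
     series (fun k => mcoef l k n * rho ^+ k) K * Dfun l n t|
  <= series (exp_coeff (3 * rho)) K - series (exp_coeff (3 * rho)) N.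
Proof.
move=> l0 rho0 t1 NK.
pose q k n := rho ^+ k * (weight l n * mcoef l k n * Dfun l n t).
have -> : series (exp_coeff (rho * t)) K = \sum_(0 <= k < K) \sum_(0 <= n < K) q k n.
  rewrite seriesEnat; apply: eq_big_nat => k /andP[_ kK].
  rewrite /exp_coeff /= exprMn -mulrA (monomial_expansion _ l0 kK) mulr_sumr.
  by rewrite big_mkord.
have -> : \sum_(n < N) weight l n * series (fun k => mcoef l k n * rho ^+ k) K
    * Dfun l n t = \sum_(0 <= k < K) \sum_(0 <= n < N) q k n.
  rewrite exchange_big_nat/= big_mkord; apply: eq_bigr => n _.
  rewrite seriesEnat mulr_sumr mulr_suml; apply: eq_bigr => k _.
  by rewrite /q; ring.
rewrite -sumrB (@sub_series_geq _ _ N K)//.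
(* For [k < N] truncating at [N] loses nothing, since [mcoef k n = 0] for [n >= N > k]; only the
   block [N <= k < K] remains. *)
rewrite (big_cat_nat (leq0n N) NK)/= big1_seq ?add0r; last first.
  move=> k /=; rewrite mem_index_iota => /andP[_ kN].
  rewrite (big_cat_nat (leq0n N) NK)/= addrAC subrr add0r big1_seq// => n /=.
  rewrite mem_index_iota => /andP[Nn _].
  by rewrite /q mcoef_small ?mulr0 ?mul0r ?mulr0//; exact: leq_trans Nn.
apply: (le_trans (ler_norm_sum _ _ _)); rewrite ler_sum_nat// => k /andP[Nk kK].
rewrite (big_cat_nat (leq0n N) NK)/= addrAC subrr add0r.
apply: (le_trans (ler_norm_sum _ _ _)).
(* Writing [1/k!] as the sum of [weight * mcoef] reduces the claim to a termwise comparison, where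
   [|D_n| <= 3^n <= 3^k]. This is the origin of [3 * rho]. *)
rewrite /exp_coeff /= exprMn -mulrA -(sum_weight_mcoef l0 kK) mulrCA mulr_sumr.
rewrite -(big_mkord xpredT (fun i => 3 ^+ k * (weight l i * mcoef l k i))) mulr_sumr.
have pos n : 0 <= rho ^+ k * (3 ^+ k * (weight l n * mcoef l k n)).
  by rewrite !mulr_ge0 ?exprn_ge0 ?mcoef_ge0// ltW// weight_gt0.
rewrite [leRHS](big_cat_nat (leq0n N) NK)/= ler_wpDl ?sumr_ge0//.
rewrite ler_sum_nat// => n /andP[Nn nK]; rewrite /q normrM ger0_norm ?exprn_ge0//.
rewrite ler_wpM2l ?exprn_ge0// normrM mulrC.
have wm0 : 0 <= weight l n * mcoef l k n.
  by rewrite mulr_ge0 ?mcoef_ge0// ltW// weight_gt0.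
rewrite [X in _ * X]ger0_norm//.
have [kn|nk] := ltnP k n; first by rewrite mcoef_small// mulr0 !mulr0.
rewrite ler_wpM2r//; apply: le_trans (Dfun_bound n l0 t1) _.
by rewrite ler_weXn2l// ler1n.
Qed.

Lemma expansion_le rho t N : 0 <= l -> 0 <= rho -> `|t| <= 1 ->
  `|expR (rho * t) - \sum_(n < N) weight l n * hcoef n rho * Dfun l n t|
  <= exp_tail (3 * rho) N.
Proof.
move=> l0 rho0 t1.
have cl : `|series (exp_coeff (rho * t)) K - \sum_(n < N) weight l n *
     series (fun k => mcoef l k n * rho ^+ k) K * Dfun l n t| @[K --> \oo] -->
   `|expR (rho * t) - \sum_(n < N) weight l n * hcoef n rho * Dfun l n t|.
  apply: cvg_norm; apply: cvgB; first exact: cvg_exp_series.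
  have H n : weight l n * series (fun k => mcoef l k n * rho ^+ k) K * Dfun l n t
      @[K --> \oo] --> weight l n * hcoef n rho * Dfun l n t.
    apply: cvgM; last exact: cvg_cst.
    by apply: cvgM; [exact: cvg_cst|exact: cvg_hcoef].
  exact: (@cvg_ord_sum N (fun n K => _) _ H).
have cr : series (exp_coeff (3 * rho)) K - series (exp_coeff (3 * rho)) N
   @[K --> \oo] --> exp_tail (3 * rho) N.
  by apply: cvgB; [exact: cvg_exp_series|exact: cvg_cst].
apply: (ler_cvg_to cl cr); near=> K.
apply: (@expansion_partial_le rho t N K) => //.
by near: K; exact: nbhs_infty_ge.
Unshelve. all: by end_near. Qed.

Lemma hcoef_ge0 n rho : 0 <= l -> 0 <= rho -> 0 <= hcoef n rho.
Proof.
move=> l0 rho0; apply: limr_ge; first exact/cvgP/cvg_hcoef.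
by apply: nearW => K; rewrite seriesEnat sumr_ge0// => k _;
  rewrite mulr_ge0 ?mcoef_ge0 ?exprn_ge0.
Qed.

Lemma hcoef_sum rho : 0 <= l -> 0 <= rho ->
  \sum_(n < x) weight l n * hcoef n rho @[x --> \oo] --> expR rho.
Proof.
move=> l0 rho0; apply/subr_cvg0.
apply: (@squeeze_cvgr _ _ _ _ (fun N => - exp_tail (3 * rho) N)
  (fun N => exp_tail (3 * rho) N)).
- near=> N; rewrite -ler_norml distrC.
  have := @expansion_le rho 1 N l0 rho0; rewrite normr1 mulr1 => /(_ (lexx _)).
  by under eq_bigr do rewrite Dfun1// mulr1.
- by rewrite -oppr0; apply: cvgN; exact: exp_tail_cvg0.
- exact: exp_tail_cvg0.
Unshelve. all: by end_near. Qed.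

Lemma Gamma_rising n : 0 <= l -> Gamma (l + 1 + n%:R) = Gamma (l + 1) * rising l n.
Proof.
move=> l0; elim: n => [|n IH]; first by rewrite addr0 /rising big_ord0 mulr1.
have n0 := ler0n R n.
rewrite -[n.+1%:R]natr1 addrA (@GammaD1 _ (l + 1 + n%:R)); last by lra.
by rewrite IH risingS; ring.
Qed.

Lemma series_hcoef_subseq n rho J :
  series (fun k => mcoef l k n * rho ^+ k) (n + J.*2)%N =
  series (fun j => bcoef l j n * rho ^+ (n + j.*2)) J.
Proof.
rewrite !seriesEnat /=; elim: J => [|J IH].
  rewrite addn0 [RHS]big_geq// big1_seq// => k /=.
  rewrite mem_index_iota => kn; by rewrite mcoef_small ?mul0r.
have -> : (n + J.+1.*2 = (n + J.*2).+2)%N by lia.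
by rewrite !big_nat_recr//= IH mcoef_odd mul0r addr0 mcoef_bcoef.
Qed.

(** The series agree term by term by [Gamma_rising], once the zero coefficients are skipped: the
    partial sums of [besselI] are, up to the factor, the subsequence [n + 2J] of those of
    [hcoef]. *)
Lemma besselI_hcoef n rho : 0 <= l -> 0 < rho ->
  besselI (l + n%:R) rho = (rho / 2) `^ l / Gamma (l + 1) * hcoef n rho.
Proof.
move=> l0 rho0; have r20 : 0 < rho / 2 by lra.
have G0 : Gamma (l + 1) != 0 by apply/lt0r_neq0/Gamma_gt0; lra.
rewrite /besselI; set u := (X in series X).
have -> : series u = (fun J => (rho / 2) `^ l / Gamma (l + 1) *
   series (fun k => mcoef l k n * rho ^+ k) (n + J.*2)%N).
  apply: funext => J; rewrite series_hcoef_subseq !seriesEnat /= mulr_sumr.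
  apply: eq_bigr => j _; rewrite /u /bcoef /=.
  have -> : j%:R + (l + n%:R) + 1 = l + 1 + (n + j)%:R by rewrite natrD; ring.
  have -> : 2 * j%:R + (l + n%:R) = l + (n + j.*2)%:R.
    by rewrite natrD -mul2n natrM; ring.
  rewrite Gamma_rising// powRD; last by rewrite (gt_eqF r20) implybT.
  rewrite powR_mulrn ?ltW// expr_div_n.
  have r0 := rising_gt0 (n + j) l0.
  have f0 : j`!%:R != 0 :> R by rewrite pnatr_eq0 -lt0n fact_gt0.
  by field; rewrite ?expf_neq0 ?f0 ?G0 ?gt_eqF.
apply/cvg_lim => //; apply: cvgM; first exact: cvg_cst.
apply: (@cvg_comp _ _ _ (fun J => n + J.*2)%N); last first.
  by apply: cvg_hcoef => //; exact: ltW.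
apply/cvgnyPge => K; near=> J.
have : (K <= J)%N by near: J; exact: nbhs_infty_ge.
by lia.
Unshelve. all: by end_near. Qed.

End exponential_expansion.

(** * Integration over the sphere *)

Section spherical_means.
Context {R : realType} {d : nat}.
Variable sigma : probability (euclidean R d) R.
Implicit Types (v w x eta : euclidean R d) (A : set (euclidean R d)).
Implicit Types (h g : euclidean R d -> R) (k n : nat).

Local Notation S := [set x : euclidean R d | on_sphere x].

Lemma dot_ge0 v : 0 <= dot v v.
Proof. by apply: sumr_ge0 => i _; rewrite -expr2 sqr_ge0. Qed.

Lemma on_sphereE x : on_sphere x <-> dot x x = 1.
Proof.
split => [sx|sx]; last by rewrite /on_sphere sx sqrtr1.
by rewrite -(sqr_sqrtr (dot_ge0 x)) sx expr1n.
Qed.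

(** Cauchy-Schwarz for unit vectors, from [|x + e v|^2 >= 0] at [e = 1] and [e = -1]. *)
Lemma dot_le1 v x : on_sphere v -> on_sphere x -> `|dot v x| <= 1.
Proof.
move=> /on_sphereE v1 /on_sphereE x1.
have pos (e : R) : 0 <= dot x x + 2 * e * dot v x + e ^+ 2 * dot v v.
  rewrite /dot !mulr_sumr -!big_split sumr_ge0// => i _ /=.
  have -> : tnth x i * tnth x i + 2 * e * (tnth v i * tnth x i) +
    e ^+ 2 * (tnth v i * tnth v i) = (tnth x i + e * tnth v i) ^+ 2 by ring.
  exact: sqr_ge0.
have := pos 1; have := pos (-1); rewrite x1 v1 => h1 h2.
rewrite ler_norml; lra.
Qed.

Lemma measurable_sphere : measurable S.
Proof.
have -> : S = (fun x : euclidean R d => dot x x) @^-1` [set 1].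
  by apply/seteqP; split => x /=; rewrite on_sphereE.
rewrite -[X in measurable X]setTI.
have mf : measurable_fun [set: euclidean R d] (fun x : euclidean R d => dot x x).
  by apply: measurable_sum => i; apply: measurable_funM; exact: measurable_tnth.
by apply: mf.
Qed.

(** Distributions live on the whole space, where [dot eta] is unbounded. Asking for a bound on the
    sphere only, and integrating over [A] cut down to the sphere, gives a class of integrable
    functions closed under the algebra needed; [integral_tame] removes the cut for uniform
    [sigma]. *)
Definition tame h : Prop :=
  measurable_fun [set: euclidean R d] h /\
  exists C : R, forall x, on_sphere x -> `|h x| <= C.

Definition mean A h : R := \int[sigma]_(x in A `&` S) h x.

Lemma tame_cst (c : R) : tame (fun=> c).
Proof. by split; [exact: measurable_cst|exists `|c|]. Qed.

Lemma tameD h g : tame h -> tame g -> tame (fun x => h x + g x).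
Proof.
move=> [mh [C hC]] [mg [D gD]]; split; first exact: measurable_funD.
exists (C + D) => x Sx; apply: (le_trans (ler_normD _ _)).
by rewrite lerD ?hC ?gD.
Qed.

Lemma tameM h g : tame h -> tame g -> tame (fun x => h x * g x).
Proof.
move=> [mh [C hC]] [mg [D gD]]; split; first exact: measurable_funM.
by exists (C * D) => x Sx; rewrite normrM ler_pM ?hC ?gD.
Qed.

Lemma tameZ (c : R) h : tame h -> tame (fun x => c * h x).
Proof. by apply: tameM; exact: tame_cst. Qed.

Lemma tameB h g : tame h -> tame g -> tame (fun x => h x - g x).
Proof.
move=> th tg; have -> : (fun x => h x - g x) = (fun x => h x + (-1) * g x).
  by apply: funext => x; rewrite mulN1r.
by apply: tameD => //; exact: tameZ.
Qed.

Lemma tameX h k : tame h -> tame (fun x => h x ^+ k).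
Proof.
move=> th; elim: k => [|k IH]; first exact: tame_cst.
by under eq_fun do rewrite exprS; exact: tameM.
Qed.

Lemma tame_sum N (h : 'I_N -> euclidean R d -> R) :
  (forall i, tame (h i)) -> tame (fun x => \sum_(i < N) h i x).
Proof.
elim: N h => [|N IH] h th.
  by under eq_fun do rewrite big_ord0; exact: tame_cst.
by under eq_fun do rewrite big_ord_recl; apply: tameD => //; exact: IH.
Qed.

Lemma tame_tnth i : tame (fun x => tnth x i).
Proof.
split; first exact: measurable_tnth.
exists 1 => x /on_sphereE; rewrite /dot (bigD1 i)//= => sx.
rewrite -(@ler_pXn2r _ 2)// ?nnegrE// expr1n -normrX ger0_norm ?sqr_ge0//.
by rewrite -sx expr2 lerDl sumr_ge0// => j _; rewrite -expr2 sqr_ge0.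
Qed.

Lemma tame_dot v : tame (dot v).
Proof. by apply: tame_sum => i; apply: tameZ; exact: tame_tnth. Qed.

Lemma tame_expR h : tame h -> tame (fun x => expR (h x)).
Proof.
move=> [mh [C hC]]; split; first by apply: measurableT_comp.
exists (expR C) => x Sx; rewrite ger0_norm ?expR_ge0// ler_expR.
exact: le_trans (ler_norm _) (hC x Sx).
Qed.

Lemma tame_Dfun l n h : tame h -> tame (fun x => Dfun l n (h x)).
Proof.
move=> th; elim/ltn_ind: n => -[|[|n]] IH //; first exact: tame_cst.
under eq_fun do rewrite DfunSS mulrC.
by apply/tameZ/tameB; [apply: tameM; [exact: tameZ|exact: IH]
  |apply: tameZ; exact: IH].
Qed.

Lemma tame_integrable A h : measurable A -> tame h ->
  sigma.-integrable (A `&` S) (EFin \o h).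
Proof.
move=> mA [mh [C hC]]; apply: measurable_bounded_integrable.
- by apply: measurableI => //; exact: measurable_sphere.
- by apply: le_lt_trans (probability_le1 _ _) (ltry _);
    apply: measurableI => //; exact: measurable_sphere.
- exact: measurable_funTS.
- exists C; split; first exact: num_real.
  by move=> D CD x [_ Sx]; apply: le_trans (hC x Sx) (ltW CD).
Qed.

Let mAS A : measurable A -> measurable (A `&` S).
Proof. by move=> mA; apply: measurableI => //; exact: measurable_sphere. Qed.

Lemma meanD A h g : measurable A -> tame h -> tame g ->
  mean A (fun x => h x + g x) = mean A h + mean A g.
Proof. by move=> mA th tg; apply: RintegralD; [exact: mAS|exact: tame_integrable..]. Qed.

Lemma meanZ A c h : measurable A -> tame h ->
  mean A (fun x => c * h x) = c * mean A h.
Proof. by move=> mA th; apply: RintegralZl; [exact: mAS|exact: tame_integrable..]. Qed.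

Lemma meanB A h g : measurable A -> tame h -> tame g ->
  mean A (fun x => h x - g x) = mean A h - mean A g.
Proof. by move=> mA th tg; apply: RintegralB; [exact: mAS|exact: tame_integrable..]. Qed.

Lemma eq_mean A h g : (forall x, on_sphere x -> h x = g x) -> mean A h = mean A g.
Proof. by move=> hg; apply: eq_Rintegral => x; rewrite inE => -[_ /hg]. Qed.

Lemma mean_sum A N (h : 'I_N -> euclidean R d -> R) : measurable A ->
  (forall i, tame (h i)) ->
  mean A (fun x => \sum_(i < N) h i x) = \sum_(i < N) mean A (h i).
Proof.
move=> mA; elim: N h => [|N IH] h th.
  rewrite big_ord0 -[RHS](mul0r (mean A (fun=> 1))) -meanZ//; last exact: tame_cst.
  by apply: eq_mean => x _; rewrite big_ord0 mul0r.
rewrite big_ord_recl -IH// -meanD//; last exact: tame_sum.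
by apply: eq_mean => x _; rewrite big_ord_recl.
Qed.

Lemma mean_le A h g : measurable A -> tame h -> tame g ->
  (forall x, on_sphere x -> h x <= g x) -> mean A h <= mean A g.
Proof.
move=> mA th tg hg; apply: le_Rintegral; [exact: mAS|exact: tame_integrable..|].
by move=> x [_ /hg].
Qed.

Lemma mean_norm_le A h C : measurable A -> tame h -> 0 <= C ->
  (forall x, on_sphere x -> `|h x| <= C) -> `|mean A h| <= C.
Proof.
move=> mA th C0 hC.
have m1 : `|mean A (fun=> C)| <= C.
  rewrite /mean Rintegral_cst; last exact: mAS.
  rewrite ger0_norm; last by rewrite mulr_ge0// fine_ge0.
  rewrite -[leRHS]mulr1 ler_wpM2l// -[leRHS]/(fine 1%E) fine_le//.
    by apply: fin_num_measure; exact: mAS.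
  by apply: probability_le1; exact: mAS.
have mN : mean A (fun=> - C) = - mean A (fun=> C).
  rewrite -[RHS]mulN1r -meanZ//; last exact: tame_cst.
  by apply: eq_mean => x _; rewrite mulN1r.
move: m1; rewrite ler_norml => /andP[_ m1].
rewrite ler_norml; apply/andP; split.
  apply: (@le_trans _ _ (mean A (fun=> - C))); first by rewrite mN lerN2.
  apply: mean_le => //; first exact: tame_cst.
  by move=> x /hC; rewrite ler_norml => /andP[].
apply: le_trans m1; apply: mean_le => //; first exact: tame_cst.
by move=> x /hC; rewrite ler_norml => /andP[].
Qed.

End spherical_means.

(** * Comparing coefficients of polynomial functions *)

Lemma eq_horner_poly0 (R : realType) (p : {poly R}) : (forall x, p.[x] = 0) -> p = 0.
Proof.
move=> p0; apply: (@roots_geq_poly_eq0 _ _ [seq i%:R | i <- iota 0 (size p)]).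
- by apply/allP => x _; apply/rootP.
- by rewrite map_inj_uniq ?iota_uniq// => i j /eqP; rewrite eqr_nat => /eqP.
- by rewrite size_map size_iota.
Qed.

Lemma coef2_sqr1DX (R : realType) k :
  (((1 + 'X^2) ^+ k : {poly R})`_0 = 1) *
  (((1 + 'X^2) ^+ k : {poly R})`_1 = 0) *
  (((1 + 'X^2) ^+ k : {poly R})`_2 = k%:R).
Proof.
elim: k => [|k [[c0 c1] c2]]; first by rewrite expr0 !coef1.
by rewrite exprS mulrDl mul1r !coefD !coefXnM /= c0 c1 c2 !addr0 -natr1.
Qed.

(** Polynomials equal at every point of an infinite field have equal coefficients, and [(1 + X^2)^k]
    has [k] at [X^2]. The bound [2 < N] makes [c 2] one of the coefficients. *)
Lemma coef2_of_horner (R : realType) (c : nat -> R) (M : R) (k N : nat) :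
  (2 < N)%N ->
  (forall b, \sum_(i < N) c i * b ^+ i = (1 + b ^+ 2) ^+ k * M) ->
  c 2 = k%:R * M.
Proof.
move=> N2 cM.
have : \poly_(i < N) c i - M *: (1 + 'X^2) ^+ k = 0.
  apply: eq_horner_poly0 => b.
  rewrite hornerD hornerN hornerZ horner_poly cM horner_exp hornerD hornerC hornerXn.
  by rewrite mulrC subrr.
move=> /polyP/(_ 2); rewrite coef0 coefB coefZ coef_poly N2 coef2_sqr1DX.
by rewrite mulrC => /eqP; rewrite subr_eq0 => /eqP.
Qed.

(** * Consequences of rotation invariance *)

Section uniform.
Context {R : realType} {d : nat}.
Variable sigma : probability (euclidean R d) R.
Implicit Types (v w x eta : euclidean R d) (A : set (euclidean R d)).
Implicit Types (h g : euclidean R d -> R) (k n : nat).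

Local Notation S := [set x : euclidean R d | on_sphere x].

Lemma dotC v w : dot v w = dot w v.
Proof. by apply: eq_bigr => i _; rewrite mulrC. Qed.

(** The Householder reflection in [v - w] exchanges [v] and [w] because their norms agree. When
    [v = w] its formula divides by 0 and the identity is taken instead. *)
Lemma reflection_between v w : dot v v = dot w w ->
  exists2 Q : 'M[R]_d.+1, Q *m Q^T = 1%:M & forall x, dot w (mxact Q x) = dot v x.
Proof.
move=> vw; pose u : 'rV[R]_d.+1 := \row_i (tnth v i - tnth w i).
pose N := \sum_i u ord0 i * u ord0 i.
have NE : N = 2 * dot w w - 2 * dot w v.
  have -> : 2 * dot w w - 2 * dot w v = dot v v + dot w w - 2 * dot w v.
    by rewrite vw; ring.
  rewrite /N /dot mulr_sumr -big_split -sumrB; apply: eq_bigr => i _.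
  by rewrite /u !mxE /=; ring.
have uu : u *m u^T = N%:M.
  apply/matrixP => i j; rewrite !ord1 !mxE eqxx mulr1n; apply: eq_bigr => k _.
  by rewrite !mxE.
have [N0|N0] := eqVneq N 0.
  have u0 i : tnth v i = tnth w i.
    have : u ord0 i * u ord0 i == 0.
      move/eqP: N0; rewrite /N psumr_eq0 => [/allP/(_ i)|j _].
        by rewrite mem_index_enum => /(_ isT).
      by rewrite -expr2 sqr_ge0.
    by rewrite mulf_eq0 orbb /u mxE subr_eq0 => /eqP.
  exists 1%:M; first by rewrite trmx1 mulmx1.
  move=> x; apply: eq_bigr => i _; rewrite u0 tnth_mktuple (bigD1 i)//= mxE eqxx.
  rewrite mul1r big1 ?addr0// => j ji.
  by rewrite mxE eq_sym (negbTE ji) mul0r.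
exists (1%:M - (2 / N) *: (u^T *m u)).
  have -> : (1%:M - (2 / N) *: (u^T *m u))^T = 1%:M - (2 / N) *: (u^T *m u).
    rewrite [LHS]linearB /= trmx1; congr (_ - _).
    by rewrite [LHS]linearZ /= trmx_mul trmxK.
  rewrite mulmxBl mul1mx mulmxBr mulmx1 -scalemxAl -scalemxAr.
  rewrite -mulmxA (mulmxA u) uu mul_scalar_mx -scalemxAr !scalerA.
  rewrite -scalerBl -addrA -opprD -scalerDl.
  have -> : 2 / N + (2 / N - 2 / N * (2 / N * N)) = 0 by field.
  by rewrite scale0r subr0.
move=> x; rewrite {1}/dot; under eq_bigr do rewrite tnth_mktuple mulr_sumr.
rewrite exchange_big; apply: eq_bigr => j _ /=.
under eq_bigr do rewrite mulrA; rewrite -mulr_suml; congr (_ * _).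
transitivity (tnth w j - (2 / N) * u ord0 j * \sum_i tnth w i * u ord0 i).
  rewrite mulr_sumr.
  transitivity (\sum_i (tnth w i * (i == j)%:R - 2 / N * u ord0 j * (tnth w i * u ord0 i))).
    apply: eq_bigr => i _; rewrite !mxE big_ord1 !mxE.
    by rewrite mulrBr; congr (_ - _); ring.
  rewrite sumrB; congr (_ - _); rewrite (bigD1 j)//= eqxx mulr1 big1 ?addr0// => i ij.
  by rewrite (negbTE ij) mulr0.
have -> : \sum_i tnth w i * u ord0 i = - (N / 2).
  rewrite NE; have -> : - ((2 * dot w w - 2 * dot w v) / 2) = dot w v - dot w w by field.
  by rewrite /dot -sumrB; apply: eq_bigr => i _; rewrite /u mxE; ring.
by rewrite /u mxE; field.
Qed.

Lemma uniform_dot v w : is_uniform_on_sphere sigma -> dot v v = dot w w ->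
  forall B : set R, measurable B -> sigma (dot v @^-1` B) = sigma (dot w @^-1` B).
Proof.
move=> [_ inv] /reflection_between[Q QQ Qvw] B mB.
have mw : measurable (dot w @^-1` B).
  by rewrite -[X in measurable X]setTI; exact: measurable_dot.
rewrite -(inv Q QQ _ mw); congr (sigma _).
by apply/seteqP; split => x /=; rewrite Qvw.
Qed.

Lemma sphere_negligible : is_uniform_on_sphere sigma -> sigma (~` S) = 0%E.
Proof.
move=> [s1 _]; rewrite probability_setC ?s1 ?subee//; exact: measurable_sphere.
Qed.

Lemma tame_integrableT D h : is_uniform_on_sphere sigma ->
  measurable D -> tame h -> sigma.-integrable D (EFin \o h).
Proof.
move=> us mD th; have mS := @measurable_sphere R d.
apply/(negligible_integrable (measurableC mS) mD).
- by apply/measurable_EFinP/measurable_funTS; case: th.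
- exact: sphere_negligible.
- by rewrite setDE setCK; exact: tame_integrable.
Qed.

Lemma integral_tame A h : is_uniform_on_sphere sigma -> measurable A -> tame h ->
  (\int[sigma]_(x in A) (h x)%:E = (mean sigma A h)%:E)%E.
Proof.
move=> us mA th; have mS := @measurable_sphere R d.
rewrite (negligible_integral (measurableC mS) mA); last 2 first.
- exact: tame_integrableT.
- exact: sphere_negligible.
rewrite setDE setCK /mean /Rintegral fineK//; apply: integrable_fin_num.
  by apply: measurableI.
exact: tame_integrable.
Qed.

Lemma mean1 : is_uniform_on_sphere sigma -> mean sigma setT (fun=> 1) = 1.
Proof.
move=> us; apply/EFin_inj; rewrite -integral_tame//; last exact: tame_cst.
by rewrite integral_cst// mul1e; exact: probability_setT.
Qed.

(** The laws of [dot v] and [dot w] coincide. Any common norm is allowed, as [mean_mixed] compares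
    [e_0 + b e_j] with a multiple of [e_0]. *)
Lemma mean_dotX v w k : is_uniform_on_sphere sigma -> dot v v = dot w w ->
  mean sigma setT (fun x => dot v x ^+ k) = mean sigma setT (fun x => dot w x ^+ k).
Proof.
move=> us vw; have mX : measurable_fun [set: R] (fun t : R => (t ^+ k)%:E).
  by apply/measurable_EFinP; exact: exprn_measurable.
have pf u : ((mean sigma setT (fun x => dot u x ^+ k))%:E =
    \int[pushforward sigma (dot u)]_t (t ^+ k)%:E)%E.
  rewrite integral_pushforward//; last first.
    rewrite preimage_setT; apply: (tame_integrableT us) => //.
    by apply: tameX; exact: tame_dot.
  by rewrite preimage_setT -integral_tame//; apply: tameX; exact: tame_dot.
apply/EFin_inj; rewrite !pf; apply: eq_measure_integral => B mB _.
exact: (uniform_dot us vw mB).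
Qed.

Lemma inner_mean eta (f g : R -> R) : is_uniform_on_sphere sigma -> on_sphere eta ->
  measurable_fun [set: R] (fun t => f t * g t) ->
  (exists C : R, forall t : R, -1 <= t <= 1 -> `|f t * g t| <= C) ->
  inner sigma eta f g = mean sigma setT (fun x => f (dot eta x) * g (dot eta x)).
Proof.
move=> us Se mfg [C fgC]; have mS := @measurable_sphere R d.
have mD : measurable (dot eta @^-1` `[-1, 1]).
  by rewrite -[X in measurable X]setTI; exact: measurable_dot.
have tfg : tame (fun x => f (dot eta x) * g (dot eta x)).
  split; first by apply: (measurableT_comp mfg); exact: measurable_dot.
  by exists C => x Sx; apply: fgC; rewrite -ler_norml dot_le1.
rewrite /inner /mean /Rintegral setTI; congr fine.
transitivity (\int[pushforward sigma (dot eta)]_(t in `[(-1)%R, 1%R]) (f t * g t)%:E)%E.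
  by [].
rewrite integral_pushforward//; last 2 first.
- exact/measurable_EFinP.
- exact: (tame_integrableT us).
rewrite (negligible_integral (measurableC mS))//; last 2 first.
- exact: (tame_integrableT us).
- exact: sphere_negligible.
rewrite setDE setCK setIC; congr (integral _ _ _).
by apply/seteqP; split => x [] //= Sx; split=> //; rewrite in_itv/= -ler_norml dot_le1.
Qed.

End uniform.

(** Here [M i] plays the mean of [D_i]. In the expansion of [t^n] only [D_0] and [D_n] contribute;
    the [D_0] term already equals the whole moment, so the [D_n] term vanishes although its
    coefficient is positive. *)
Lemma mcoef_triangular (R : realType) (l : R) (M : nat -> R) n : M 0 = 1 -> 0 <= l ->
  (0 < n)%N -> (forall m, (0 < m)%N -> (m < n)%N -> M m = 0) ->
  mcoef l n 0 = \sum_(i < n.+1) weight l i * mcoef l n i * M i -> M n = 0.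
Proof.
move=> M0 l0; case: n => // n _ Mm.
rewrite big_ord_recl big_ord_recr /= big1 ?add0r => [|i _]; last first.
  by rewrite Mm ?mulr0//= /bump leq0n add1n ltnS.
rewrite /bump leq0n add1n weight0 mul1r M0 mulr1 => /eqP.
rewrite addrC -subr_eq subrr eq_sym mulf_eq0 => /orP[|/eqP//].
have := mcoef_bcoef l 0 n.+1; rewrite addn0 => ->.
by rewrite mulf_eq0 !gt_eqF ?weight_gt0 ?bcoef_gt0.
Qed.

(** * Moments of a coordinate and orthogonality of the polynomials *)

Section moments.
Context {R : realType} {d : nat}.
Variable sigma : probability (euclidean R d) R.
Implicit Types (v w x eta : euclidean R d) (A : set (euclidean R d)).
Implicit Types (h g : euclidean R d -> R) (k n m : nat).

Local Notation l := (lambda R d).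

Definition moment v k := mean sigma setT (fun x => dot v x ^+ k).

Definition lincomb (a b : R) v w : euclidean R d :=
  [tuple a * tnth v i + b * tnth w i | i < d.+1].

Definition basis_vec (j : 'I_d.+1) : euclidean R d := [tuple (i == j)%:R | i < d.+1].

Lemma dot_lincombl a b v w x :
  dot (lincomb a b v w) x = a * dot v x + b * dot w x.
Proof.
rewrite /dot !mulr_sumr -big_split; apply: eq_bigr => i _ /=.
by rewrite tnth_mktuple; ring.
Qed.

Lemma dot_basis j x : dot (basis_vec j) x = tnth x j.
Proof.
rewrite /dot (bigD1 j)//= tnth_mktuple eqxx mul1r big1 ?addr0// => i ij.
by rewrite tnth_mktuple (negbTE ij) mul0r.
Qed.

Lemma dot_basis2 i j : dot (basis_vec i) (basis_vec j) = (i == j)%:R.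
Proof. by rewrite dot_basis tnth_mktuple. Qed.

Lemma tame_dotX v k : tame (fun x => dot v x ^+ k).
Proof. by apply: tameX; exact: tame_dot. Qed.

Lemma moment_odd eta k : is_uniform_on_sphere sigma -> odd k -> moment eta k = 0.
Proof.
move=> us ok.
(* This linear combination is [-eta], which has the norm of [eta]. *)
have /(mean_dotX k us) : dot (lincomb (-1) 0 eta eta) (lincomb (-1) 0 eta eta) = dot eta eta.
  by rewrite dot_lincombl ![dot _ (lincomb _ _ _ _)]dotC !dot_lincombl; ring.
rewrite -[RHS]/(moment eta k).
have -> : mean sigma setT (fun x => dot (lincomb (-1) 0 eta eta) x ^+ k) = - moment eta k.
  rewrite -[RHS]mulN1r /moment -meanZ//; last exact: tame_dotX.
  apply: eq_mean => x _; rewrite dot_lincombl mul0r addr0 exprMn.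
  by rewrite -signr_odd ok expr1.
by lra.
Qed.

Lemma mean_mixed k (j : 'I_d) : is_uniform_on_sphere sigma ->
  'C(k.*2, 2)%:R * mean sigma setT (fun x => tnth x ord0 ^+ (k.*2 - 2) *
     tnth x (lift ord0 j) ^+ 2) = k%:R * moment (basis_vec ord0) k.*2.
Proof.
move=> us; case: k => [|k]; first by rewrite bin0n !mul0r.
pose u x := tnth x ord0; pose z x := tnth x (lift ord0 j).
pose N := k.+1.*2.
have tu i : tame (fun x => u x ^+ i) by apply: tameX; exact: tame_tnth.
have tz i : tame (fun x => z x ^+ i) by apply: tameX; exact: tame_tnth.
have tuz i : tame (fun x => u x ^+ (N - i) * z x ^+ i) by exact: tameM.
apply: (@coef2_of_horner R (fun i => 'C(N, i)%:R * mean sigma setT (fun x =>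
  u x ^+ (N - i) * z x ^+ i)) _ k.+1 N.+1); first by rewrite /N; lia.
move=> b; set e := basis_vec ord0; set f := basis_vec (lift ord0 j).
have ef : dot (lincomb 1 b e f) (lincomb 1 b e f) = 1 + b ^+ 2.
  rewrite dot_lincombl ![dot _ (lincomb _ _ _ _)]dotC !dot_lincombl.
  by rewrite /e /f !dot_basis2 !eqxx /=; ring.
(* The vector [s e_0] has the norm of [e_0 + b e_j]; the even exponent [N] then removes the square
   root. *)
pose s := Num.sqrt (1 + b ^+ 2).
have b1 : 0 <= 1 + b ^+ 2 by rewrite addr_ge0 ?sqr_ge0.
have s2 : s ^+ 2 = 1 + b ^+ 2 by rewrite sqr_sqrtr.
have ss : dot (lincomb s 0 e e) (lincomb s 0 e e) = 1 + b ^+ 2.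
  rewrite dot_lincombl ![dot _ (lincomb _ _ _ _)]dotC !dot_lincombl /e !dot_basis2.
  by rewrite eqxx -s2 /=; ring.
have := mean_dotX N us (etrans ef (esym ss)).
have -> : mean sigma setT (fun x => dot (lincomb s 0 e e) x ^+ N) =
    (1 + b ^+ 2) ^+ k.+1 * moment e N.
  rewrite /moment -meanZ//; last exact: tame_dotX.
  apply: eq_mean => x _; rewrite dot_lincombl mul0r addr0 exprMn; congr (_ * _).
  by rewrite /N -mul2n exprM s2.
move=> <-; under eq_bigr do rewrite mulrAC -meanZ//.
rewrite -mean_sum//; last by move=> i; exact: tameZ.
apply: eq_mean => x _; rewrite dot_lincombl mul1r !dot_basis exprDn.
apply: eq_bigr => i _; rewrite exprMn -/(u x) -/(z x) -mulr_natl; ring.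
Qed.

(** Write [k + 2 = 2 p]. Summing [mean_mixed] over [j] and using [sum_j x_j^2 = 1 - x_0^2] on the
    sphere gives [p (2p - 1) (m_k - m_(k+2)) = d p m_(k+2)] for the moments [m]. *)
Lemma moment_rec eta k : (0 < d)%N -> is_uniform_on_sphere sigma ->
  on_sphere eta ->
  (k%:R + 1 + d%:R) * moment eta k.+2 = k.+1%:R * moment eta k.
Proof.
move=> d0 us /on_sphereE e1.
have [ok|ek] := boolP (odd k).
  by rewrite !moment_odd ?mulr0//= negbK.
have mE n : moment eta n = moment (basis_vec ord0) n.
  by apply: mean_dotX => //; rewrite e1 dot_basis2 eqxx.
rewrite !mE.
have kE : k = k./2.*2 by rewrite -[LHS]odd_double_half (negbTE ek).
pose p := k./2.+1.
have pE : k.+2 = p.*2 by rewrite {1}kE.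
have te : tame (fun x => tnth x ord0 ^+ k : R) by apply: tameX; exact: tame_tnth.
have te2 : tame (fun x => tnth x ord0 ^+ k.+2 : R) by apply: tameX; exact: tame_tnth.
have tj (j : 'I_d) : tame (fun x => tnth x ord0 ^+ k * tnth x (lift ord0 j) ^+ 2 : R).
  by apply: tameM => //; apply: tameX; exact: tame_tnth.
have sumE : \sum_(j < d) mean sigma setT (fun x => tnth x ord0 ^+ k *
     tnth x (lift ord0 j) ^+ 2) = moment (basis_vec ord0) k - moment (basis_vec ord0) k.+2.
  rewrite -mean_sum// /moment -meanB//; try exact: tame_dotX.
  apply: eq_mean => x /on_sphereE x1; rewrite -mulr_sumr !dot_basis.
  rewrite -[k.+2]addn2 exprD -{2}[_ ^+ k]mulr1 -mulrBr; congr (_ * _).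
  rewrite -x1 /dot big_ord_recl expr2 addrC addKr.
  by apply: eq_bigr => i _; rewrite expr2.
have bin2E : 'C(p.*2, 2)%:R = p%:R * (2 * p%:R - 1) :> R.
  have -> : 'C(p.*2, 2) = (p * (p.*2 - 1))%N.
    by rewrite bin2 -subn1 -doubleMl doubleK.
  by rewrite natrM natrB ?double_gt0// -mul2n natrM.
have := @mean_mixed p ^~ us; rewrite -pE subn2 /= => mix.
have : \sum_(j < d) 'C(k.+2, 2)%:R * mean sigma setT (fun x => tnth x ord0 ^+ k *
     tnth x (lift ord0 j) ^+ 2) = \sum_(j < d) p%:R * moment (basis_vec ord0) k.+2.
  by apply: eq_bigr => j _; exact: mix.
rewrite -mulr_sumr sumE sumr_const card_ord pE bin2E -[RHS]mulr_natl -!pE.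
have kp : k%:R = 2 * p%:R - 2 :> R.
  have := congr1 (fun n => n%:R : R) pE.
  by rewrite -addn2 natrD -mul2n natrM => <-; rewrite addrK.
have p0 : p%:R != 0 :> R by rewrite pnatr_eq0.
rewrite -[k.+1%:R]natr1 kp.
move: (moment _ k.+2) (moment _ k) (p%:R : R) (d%:R : R) p0 => x y q D q0 H.
by apply: (mulfI q0); clear -H; lra.
Qed.

Lemma lambdaE : (d%:R : R) = 2 * l + 1.
Proof. by rewrite /lambda; field. Qed.

Lemma lambda_ge0 : (0 < d)%N -> 0 <= l.
Proof. by move=> d0; rewrite /lambda divr_ge0// subr_ge0 ler1n. Qed.

Lemma moment0 eta : is_uniform_on_sphere sigma -> moment eta 0 = 1.
Proof. by move=> us; rewrite -[RHS](mean1 us); apply: eq_mean. Qed.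

Lemma moment_mcoef eta k : (0 < d)%N -> is_uniform_on_sphere sigma ->
  on_sphere eta -> moment eta k = k`!%:R * mcoef l k 0.
Proof.
move=> d0 us Se; have l0 := lambda_ge0 d0.
case: (mcoefP k 0) => [//|j ->|j ->]; rewrite add0n; last first.
  by rewrite (mcoef_odd l j 0) mulr0 moment_odd//= odd_double.
rewrite (mcoef_bcoef l j 0); elim: j => [|j IH].
  by rewrite moment0// /bcoef /rising !big_ord0 fact0 !mul1r ?expr0 ?mul1r invr1.
have := moment_rec j.*2 d0 us Se; rewrite IH -doubleS => H.
have j0 := ler0n R j.*2.
have c0 : j.*2%:R + 1 + d%:R != 0 :> R.
  by rewrite lt0r_neq0// ltr_wpDr// ltr_wpDl.
apply: (mulfI c0); rewrite H lambdaE doubleS !factS /bcoef !add0n doubleS risingS.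
rewrite !exprS factS !natrM -[j.*2.+2%:R]natr1 -![j.*2.+1%:R]natr1 -[j.+1%:R]natr1.
rewrite -[in j.*2%:R]mul2n natrM.
have r0 := rising_gt0 j l0.
have f0 : j`!%:R != 0 :> R by rewrite pnatr_eq0 -lt0n fact_gt0.
have jj := ler0n R j.
by field; rewrite ?expf_neq0 ?f0 ?(gt_eqF r0)//=; repeat (apply/andP; split); lra.
Qed.

Definition gram (eta : euclidean R d) m n :=
  mean sigma setT (fun x => Dfun l m (dot eta x) * Dfun l n (dot eta x)).

Lemma tame_Dfun_dot eta n : tame (fun x => Dfun l n (dot eta x)).
Proof. by apply: tame_Dfun; exact: tame_dot. Qed.

Lemma mean_Dfun eta n : (0 < d)%N -> is_uniform_on_sphere sigma ->
  on_sphere eta -> (0 < n)%N ->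
  mean sigma setT (fun x => Dfun l n (dot eta x)) = 0.
Proof.
move=> d0 us Se; have l0 := lambda_ge0 d0.
elim/ltn_ind: n => n IH n0.
have mn : moment eta n = n`!%:R * \sum_(i < n.+1) weight l i * mcoef l n i *
    mean sigma setT (fun x => Dfun l i (dot eta x)).
  rewrite mulr_sumr.
  under eq_bigr => i _ do
    rewrite mulrA -(meanZ _ _ measurableT (tame_Dfun_dot eta i)).
  rewrite -mean_sum//; last by move=> i; apply: tameZ; exact: tame_Dfun_dot.
  apply: eq_mean => x _; under eq_bigr do rewrite -mulrA.
  rewrite -mulr_sumr -(monomial_expansion _ l0 (ltnSn n)) mulrC divfK//.
have f0 : n`!%:R != 0 :> R by rewrite pnatr_eq0 -lt0n fact_gt0.
move: mn; rewrite moment_mcoef// => /(mulfI f0).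
move=> mE; pose M i := mean sigma setT (fun x => Dfun l i (dot eta x)).
by apply: (@mcoef_triangular R l M n (mean1 us) l0 n0 _ mE) => m m0 mn; exact: IH.
Qed.

(** Both sides are the mean of [t D_m D_n]: multiplication by [t] is symmetric. *)
Lemma gramX eta m n : is_uniform_on_sphere sigma -> (0 < d)%N ->
  up l m * gram eta m.+1 n + down l m * gram eta m.-1 n =
  up l n * gram eta m n.+1 + down l n * gram eta m n.-1.
Proof.
move=> us d0; have l0 := lambda_ge0 d0.
have tD := tame_Dfun_dot eta.
have tDD i j : tame (fun x => Dfun l i (dot eta x) * Dfun l j (dot eta x)) by exact: tameM.
rewrite -!meanZ// -!meanD//; try exact: tameZ.
apply: eq_mean => x _; have Xm := DfunX m (dot eta x) l0.
have Xn := DfunX n (dot eta x) l0.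
transitivity ((up l m * Dfun l m.+1 (dot eta x) + down l m * Dfun l m.-1 (dot eta x)) *
  Dfun l n (dot eta x)); first by ring.
rewrite -Xm; transitivity (Dfun l m (dot eta x) * (dot eta x * Dfun l n (dot eta x))).
  by ring.
by rewrite Xn; ring.
Qed.

Lemma gramC eta m n : gram eta m n = gram eta n m.
Proof. by apply: eq_mean => x _; rewrite mulrC. Qed.

(** Induction on the smaller index, starting from [mean_Dfun]. In [gramX] at [m, n] with
    [m + 1 < n], the entries other than the wanted one have a smaller first index, still below the
    second. *)
Lemma gram_orth eta m n : (0 < d)%N -> is_uniform_on_sphere sigma ->
  on_sphere eta -> (m < n)%N -> gram eta m n = 0.
Proof.
move=> d0 us Se; have l0 := lambda_ge0 d0.
elim/ltn_ind: m n => -[|m] IH n mn.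
  rewrite -[RHS](mean_Dfun d0 us Se mn); apply: eq_mean => x _.
  by rewrite mul1r.
have := gramX eta m n us d0.
rewrite (IH m) ?(IH m _ n.-1)//; try lia.
rewrite mulr0 mulr0 addr0.
have -> : down l m * gram eta m.-1 n = 0.
  case: m IH mn => [|m] IH mn; first by rewrite /down mul0r mul0r.
  by rewrite IH ?mulr0//=; lia.
by rewrite addr0 => /eqP; rewrite mulf_eq0 gt_eqF ?up_gt0//= => /eqP.
Qed.

(** By orthogonality [gramX] at [n, n + 1] reduces to [up n * |D_(n+1)|^2 = down n.+1 * |D_n|^2].
    This is the recurrence of [weight] inverted, which explains why [weight] is the inverse squared
    norm. *)
Lemma gram_gt0 eta n : (0 < d)%N -> is_uniform_on_sphere sigma ->
  on_sphere eta -> 0 < gram eta n n.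
Proof.
move=> d0 us Se; have l0 := lambda_ge0 d0.
elim: n => [|n IH].
  rewrite (_ : gram _ _ _ = 1) ?ltr01// -(mean1 us); apply: eq_mean => x _.
  by rewrite mul1r.
have := gramX eta n n.+1 us d0; rewrite (gram_orth _ us Se (_ : n < n.+2)%N)// mulr0 add0r /=.
have -> : down l n * gram eta n.-1 n.+1 = 0.
  case: n {IH} => [|n]; first by rewrite /down mul0r mul0r.
  by rewrite gram_orth ?mulr0//=; lia.
rewrite addr0 => H; have u0 := up_gt0 n l0.
by rewrite -(pmulr_rgt0 _ u0) H mulr_gt0// down_gt0.
Qed.

End moments.

(** * Identification with Chebyshev and Gegenbauer polynomials *)

Section orthogonal_polynomials.
Context {R : realType}.
Implicit Types (l t rho : R) (n : nat).

(** The value of the Gegenbauer polynomial at 1, that is [(2 l)_n / n!]. *)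
Definition gegenbauer1 l n : R := \prod_(i < n) ((2 * l + i%:R) / i.+1%:R).

Lemma gegenbauerE l n t : 0 < l ->
  (gegenbauer l n).[t] = gegenbauer1 l n * Dfun l n t.
Proof.
move=> l0; have rec k : gegenbauer1 l k.+1 = gegenbauer1 l k * ((2 * l + k%:R) / k.+1%:R).
  by rewrite /gegenbauer1 big_ord_recr.
elim/ltn_ind: n => -[|[|n]] IH.
- by rewrite /= hornerC /gegenbauer1 big_ord0 mulr1.
- by rewrite /= hornerZ hornerX /gegenbauer1 big_ord1 addr0 divr1.
have -> : gegenbauer l n.+2 = (n.+2%:R)^-1 *:
  ((2 * (n.+1%:R + l)) *: 'X * gegenbauer l n.+1 - (n%:R + 2 * l) *: gegenbauer l n) by [].
rewrite hornerZ hornerD hornerN hornerM !hornerZ hornerX !IH// !rec DfunSS.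
have n0 := ler0n R n; rewrite -[n.+2%:R]natr1 -![n.+1%:R]natr1.
by field; repeat (apply/andP; split); lra.
Qed.

Lemma gegenbauer1_gt0 l n : 0 < l -> 0 < gegenbauer1 l n.
Proof.
move=> l0; rewrite /gegenbauer1 prodr_gt0// => i _; rewrite divr_gt0//.
by have := ler0n R i; lra.
Qed.

Lemma chebyshevE n t : (chebyshevT n).[t] = Dfun 0 n t.
Proof.
elim/ltn_ind: n => -[|[|n]] IH; [by rewrite /= hornerC|by rewrite /= hornerX|].
have -> : chebyshevT n.+2 = 2 *: 'X * chebyshevT n.+1 - chebyshevT n :> {poly R} by [].
rewrite hornerD hornerN hornerM hornerZ hornerX !IH// DfunSS.
by field; rewrite -?natr1; have := ler0n R n; lra.
Qed.

Lemma DpolyE l n t : 0 <= l -> Dpoly l n t = Dfun l n t.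
Proof.
move=> l0; rewrite /Dpoly; case: eqVneq => [->|ln0]; first exact: chebyshevE.
have {}l0 : 0 < l by rewrite lt_neqAle eq_sym ln0.
rewrite !gegenbauerE// Dfun1 ?ltW// mulr1 mulrC mulKf// gt_eqF//.
exact: gegenbauer1_gt0.
Qed.

(** The source of the factor 2 in [psk]. The index 0 is excluded, its weight being 1. *)
Lemma weight_chebyshev n : weight (0 : R) n.+1 = 2.
Proof.
elim: n => [|n IH]; have := weightS _ (lexx (0 : R)).
  by move/(_ 0%N); rewrite weight0 /= mul1r /down addr0 -[0.+1]/1%N; lra.
move/(_ n.+1); rewrite IH /= /down mulr0 !addr0.
have a0 : n.+1%:R != 0 :> R by rewrite pnatr_eq0.
have b0 : n.+2%:R != 0 :> R by rewrite pnatr_eq0.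
move: (n.+1%:R : R) (n.+2%:R : R) a0 b0 => a b a0 b0.
have -> : b / (2 * b) = 1 / 2 by field.
have -> : a / (2 * a) = 1 / 2 by field.
lra.
Qed.

(** The source of the factors of [gpsk] that do not involve [tau]. *)
Lemma weight_gegenbauer l n : 0 < l ->
  weight l n = (1 + n%:R / l) * gegenbauer1 l n.
Proof.
move=> l0; elim: n => [|n IH].
  by rewrite weight0 /gegenbauer1 big_ord0 mul0r addr0 mulr1.
have n0 := ler0n R n; have d0 := down_gt0 n (ltW l0).
apply: (mulIf (lt0r_neq0 d0)); rewrite weightS 1?ltW// IH.
rewrite /gegenbauer1 big_ord_recr -/(gegenbauer1 l n) /=.
(* For [l > 0] the separately defined [up 0 = 1] agrees with the general formula. *)
have -> : up l n = (n%:R + 2 * l) / (2 * (n%:R + l)).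
  by case: n {IH n0 d0} => //=; field; lra.
rewrite /down -![n.+1%:R]natr1.
by field; repeat (apply/andP; split); lra.
Qed.

Lemma pochhammerE l n : 1 <= 2 * l ->
  pochhammer (2 * l) n / n`!%:R = gegenbauer1 l n.
Proof.
move=> l1; have G0 : Gamma (2 * l) != 0 by apply/lt0r_neq0/Gamma_gt0.
elim: n => [|n IH].
  by rewrite /pochhammer addr0 divff// fact0 divr1 /gegenbauer1 big_ord0.
rewrite /gegenbauer1 big_ord_recr -/(gegenbauer1 l n) /= -IH /pochhammer.
have n0 := ler0n R n.
rewrite -[X in Gamma (2 * l + X)]natr1 addrA (@GammaD1 _ (2 * l + n%:R)); last by lra.
rewrite factS natrM -![n.+1%:R]natr1.
have f0 : n`!%:R != 0 :> R by rewrite pnatr_eq0 -lt0n fact_gt0.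
by field; rewrite f0 G0 /=; lra.
Qed.

Lemma measurable_Dfun l n : measurable_fun [set: R] (Dfun l n).
Proof.
elim/ltn_ind: n => -[|[|n]] IH; [exact: measurable_cst|exact: measurable_id|].
have -> : Dfun l n.+2 = fun t =>
  (2 * (n.+1%:R + l) * t * Dfun l n.+1 t - n.+1%:R * Dfun l n t) / (n.+1%:R + 2 * l) by [].
apply: measurable_funM; last exact: measurable_cst.
apply: measurable_funB; apply: measurable_funM; try exact: IH.
  by apply: measurable_funM; [exact: measurable_cst|exact: measurable_id].
exact: measurable_cst.
Qed.

Lemma eseries_from1 (u : nat -> R) (s : R) :
  \sum_(n < N) u n @[N --> \oo] --> s ->
  (\sum_(1 <= n <oo) (u n)%:E = (s - u 0)%:E)%E.
Proof.
move=> us; apply/cvg_lim => //; rewrite -(cvg_shiftS _).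
have -> : (fun N => \sum_(1 <= n < N.+1) (u n)%:E)%E =
    EFin \o (fun N => \sum_(n < N.+1) u n - u 0).
  apply: funext => N /=; rewrite sumEFin; congr EFin.
  by rewrite big_ord_recl addrC addrA addNr add0r big_add1 /= big_mkord.
apply: cvg_EFin; first exact: nearW.
apply: cvgB; last exact: cvg_cst.
by rewrite (cvg_shiftS (fun N => \sum_(n < N) u n)).
Qed.

End orthogonal_polynomials.

(** * Coefficients and mixture representation of the von Mises-Fisher family *)

Section von_Mises_Fisher.
Context {R : realType} {d : nat}.
Variable sigma : probability (euclidean R d) R.
Implicit Types (eta : euclidean R d) (A : set (euclidean R d)).
Implicit Types (h : euclidean R d -> R) (rho : R) (k n m : nat).

Local Notation l := (lambda R d).
Local Notation c0 rho := (hcoef l 0 rho).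

Lemma tame_expR_dot eta rho : tame (fun x => expR (rho * dot eta x)).
Proof. by apply/tame_expR/tameZ/tame_dot. Qed.

(** Uniform convergence on the sphere permits termwise integration. With [h = D_m] and [A] the whole
    space it yields the coefficients; with [h = 1] and arbitrary [A], the mixture. *)
Lemma mean_expR_cvg eta A h rho (C : R) : (0 < d)%N -> is_uniform_on_sphere sigma ->
  on_sphere eta -> 0 <= rho -> measurable A -> tame h -> 0 <= C ->
  (forall x, on_sphere x -> `|h x| <= C) ->
  \sum_(n < N) weight l n * hcoef l n rho *
     mean sigma A (fun x => Dfun l n (dot eta x) * h x) @[N --> \oo]
  --> mean sigma A (fun x => expR (rho * dot eta x) * h x).
Proof.
move=> d0 us Se r0 mA th C0 hC; have l0 := @lambda_ge0 R d d0.
have te := tame_expR_dot eta rho.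
have tD n : tame (fun x => Dfun l n (dot eta x) * h x).
  by apply: tameM => //; exact: tame_Dfun_dot.
have bound N : `|mean sigma A (fun x => expR (rho * dot eta x) * h x) -
    \sum_(n < N) weight l n * hcoef l n rho *
     mean sigma A (fun x => Dfun l n (dot eta x) * h x)| <= exp_tail (3 * rho) N * C.
  under eq_bigr => n _ do rewrite -(meanZ _ _ mA (tD n)).
  rewrite -mean_sum//; last by move=> i; exact: tameZ.
  have ts : tame (fun x => \sum_(i < N) weight l i * hcoef l i rho * (Dfun l i (dot eta x) * h x)).
    by apply: tame_sum => i; exact: tameZ.
  have pw x : on_sphere x -> `|expR (rho * dot eta x) * h x -
      \sum_(i < N) weight l i * hcoef l i rho * (Dfun l i (dot eta x) * h x)|
      <= exp_tail (3 * rho) N * C.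
    move=> Sx; under eq_bigr do rewrite mulrA; rewrite -mulr_suml -mulrBl normrM.
    by rewrite ler_pM ?hC// expansion_le// dot_le1.
  rewrite -meanB//; last exact: tameM.
  apply: mean_norm_le => //; first by apply: tameB => //; exact: tameM.
  by apply: le_trans (pw eta Se); exact: normr_ge0.
apply/subr_cvg0.
apply: (@squeeze_cvgr _ _ _ _ (fun N => - (exp_tail (3 * rho) N * C))
  (fun N => exp_tail (3 * rho) N * C)).
- by apply: nearW => N; rewrite -ler_norml distrC.
- rewrite -oppr0 -(mul0r C); apply: cvgN; apply: cvgM; last exact: cvg_cst.
  exact: exp_tail_cvg0.
- rewrite -[X in _ --> X](mul0r C); apply: cvgM; last exact: cvg_cst.
  exact: exp_tail_cvg0.
Qed.

Lemma mean_expR_Dfun eta rho m : (0 < d)%N -> is_uniform_on_sphere sigma ->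
  on_sphere eta -> 0 <= rho ->
  mean sigma setT (fun x => expR (rho * dot eta x) * Dfun l m (dot eta x)) =
  weight l m * hcoef l m rho * gram sigma eta m m.
Proof.
move=> d0 us Se r0; have l0 := @lambda_ge0 R d d0.
have := @mean_expR_cvg eta setT (fun x => Dfun l m (dot eta x)) rho (3 ^+ m)
  d0 us Se r0 measurableT (tame_Dfun_dot eta m).
move=> /(_ (exprn_ge0 _ _) (fun x Sx => Dfun_bound m l0 (dot_le1 Se Sx))).
move=> /(_ ltac:(by [])) cv; apply/esym.
rewrite -(cvg_lim _ cv)//; apply/esym/cvg_lim => //.
(* From index [m + 1] on the partial sums are constant, by orthogonality. *)
rewrite -(cvg_shiftn m.+1).
apply: cvg_near_cst; apply: nearW => N.
have mN : (m < N + m.+1)%N by lia.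
rewrite /= (bigD1 (Ordinal mN))//= big1 ?addr0// => i im.
rewrite -/(gram sigma eta i m).
have im' : nat_of_ord i != m by apply: contra im => /eqP E; apply/eqP/val_inj.
have [lt|gt|/eqP] := ltngtP i m; last by rewrite (negbTE im').
  by rewrite gram_orth ?mulr0.
by rewrite gramC gram_orth ?mulr0.
Qed.

Lemma gram00 eta : is_uniform_on_sphere sigma -> gram sigma eta 0 0 = 1.
Proof. by move=> us; rewrite -[RHS](mean1 us); apply: eq_mean => x _; rewrite mul1r. Qed.

Lemma mean_expR eta rho : (0 < d)%N -> is_uniform_on_sphere sigma ->
  on_sphere eta -> 0 <= rho ->
  mean sigma setT (fun x => expR (rho * dot eta x)) = c0 rho.
Proof.
move=> d0 us Se r0; have := mean_expR_Dfun 0 d0 us Se r0.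
rewrite gram00// weight0 mul1r mulr1 => <-.
by apply: eq_mean => x _; rewrite mulr1.
Qed.

Lemma hcoef0_gt0 eta rho : (0 < d)%N -> is_uniform_on_sphere sigma ->
  on_sphere eta -> 0 <= rho -> 0 < c0 rho.
Proof.
move=> d0 us Se r0; rewrite -(mean_expR d0 us Se r0).
apply: (@lt_le_trans _ _ (expR (- rho))); first exact: expR_gt0.
rewrite -[leLHS]mulr1 -(mean1 us) -meanZ//; last exact: tame_cst.
apply: mean_le => //; [exact/tameZ/tame_cst|exact: tame_expR_dot|].
move=> x Sx; rewrite mulr1 ler_expR; have := dot_le1 Se Sx.
by rewrite ler_norml => /andP[h _]; rewrite -mulrN1 ler_wpM2l.
Qed.

Lemma bessel_normalization rho : (0 < d)%N -> 0 < rho ->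
  2 `^ l * Gamma (l + 1) * besselI l rho = rho `^ l * c0 rho.
Proof.
move=> d0 r0; have l0 := @lambda_ge0 R d d0.
have G0 : Gamma (l + 1) != 0 by apply/lt0r_neq0/Gamma_gt0; rewrite lerDr.
have := besselI_hcoef 0 l0 r0; rewrite addr0 => ->.
have -> : rho `^ l = 2 `^ l * (rho / 2) `^ l.
  rewrite -powRM ?divr_ge0// 1?ltW//; congr (powR _ l).
  by rewrite mulrC divfK.
by field.
Qed.

Lemma mf_profileE rho t : (0 < d)%N -> 0 < rho ->
  mf_profile d rho t = (c0 rho)^-1 * expR (rho * t).
Proof.
move=> d0 r0; rewrite /mf_profile gt_eqF// bessel_normalization//.
have r1 : rho `^ l != 0 by rewrite gt_eqF// powR_gt0.
by rewrite invfM mulrA divff// mul1r.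
Qed.

Lemma inner_expR_Dfun eta rho c n : (0 < d)%N -> is_uniform_on_sphere sigma ->
  on_sphere eta ->
  inner sigma eta (fun t => c * expR (rho * t)) (Dfun l n) =
  c * mean sigma setT (fun x => expR (rho * dot eta x) * Dfun l n (dot eta x)).
Proof.
move=> d0 us Se; have l0 := @lambda_ge0 R d d0.
rewrite inner_mean//; last 2 first.
- apply: measurable_funM; last exact: measurable_Dfun.
  apply: measurable_funM; first exact: measurable_cst.
  by apply: measurableT_comp; [exact: measurable_expR|exact: measurable_funM].
- exists (`|c| * expR `|rho| * 3 ^+ n) => t t1.
  have {}t1 : `|t| <= 1 by rewrite ler_norml.
  rewrite !normrM ler_pM ?Dfun_bound// ler_pM// ger0_norm ?expR_ge0// ler_expR.
  by apply: (le_trans (ler_norm _)); rewrite normrM -[leRHS]mulr1 ler_pM.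
rewrite -meanZ//; last by apply: tameM; [exact: tame_expR_dot|exact: tame_Dfun_dot].
by apply: eq_mean => x _; rewrite mulrA.
Qed.

Lemma inner_Dfun eta n : (0 < d)%N -> is_uniform_on_sphere sigma ->
  on_sphere eta -> inner sigma eta (Dfun l n) (Dfun l n) = gram sigma eta n n.
Proof.
move=> d0 us Se; have l0 := @lambda_ge0 R d d0.
rewrite inner_mean//; first by apply: measurable_funM; exact: measurable_Dfun.
exists (3 ^+ n * 3 ^+ n) => t t1.
have {}t1 : `|t| <= 1 by rewrite ler_norml.
by rewrite normrM ler_pM ?Dfun_bound.
Qed.

Lemma beta_coef_mf eta rho n : (0 < d)%N -> is_uniform_on_sphere sigma ->
  on_sphere eta -> 0 < rho ->
  beta_coef sigma eta (mf_profile d rho) n = weight l n * hcoef l n rho / c0 rho.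
Proof.
move=> d0 us Se r0; have l0 := @lambda_ge0 R d d0.
rewrite /beta_coef.
have -> : Dpoly l n = Dfun l n by apply: funext => t; exact: DpolyE.
have -> : mf_profile d rho = fun t => (c0 rho)^-1 * expR (rho * t).
  by apply: funext => t; exact: mf_profileE.
rewrite inner_expR_Dfun// inner_Dfun// mean_expR_Dfun ?ltW//.
have g0 := gram_gt0 n d0 us Se.
by rewrite mulrA mulfK ?gt_eqF// mulrC.
Qed.

Lemma beta_mf eta rho : (0 < d)%N -> is_uniform_on_sphere sigma ->
  on_sphere eta -> 0 < rho ->
  beta sigma eta (mf_profile d rho) = (expR rho / c0 rho - 1)%:E.
Proof.
move=> d0 us Se r0; have l0 := @lambda_ge0 R d d0.
have h0 := hcoef0_gt0 d0 us Se (ltW r0).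
pose u n := weight l n * hcoef l n rho / c0 rho.
have u0 : u 0 = 1 by rewrite /u weight0 mul1r divff// gt_eqF.
rewrite /beta -u0 -eseries_from1.
  apply: eq_eseriesr => n _; rewrite beta_coef_mf// ger0_norm//.
  apply: divr_ge0; last exact: ltW.
  by apply: mulr_ge0; [apply/ltW/weight_gt0|apply/hcoef_ge0/ltW].
under eq_cvg do rewrite -mulr_suml; apply: cvgM; last exact: cvg_cst.
by apply: hcoef_sum => //; exact: ltW.
Qed.

Lemma beta_mf0 eta : (0 < d)%N -> is_uniform_on_sphere sigma -> on_sphere eta ->
  beta sigma eta (mf_profile d 0) = 0%E.
Proof.
move=> d0 us Se; have l0 := @lambda_ge0 R d d0.
apply: eseries0 => n n1 _; rewrite /beta_coef.
have -> : Dpoly l n = Dfun l n by apply: funext => t; exact: DpolyE.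
have -> : mf_profile d 0 = fun t : R => 1 * expR (0 * t).
  by apply: funext => t; rewrite /mf_profile eqxx mul0r expR0 mulr1.
rewrite inner_expR_Dfun// mul1r.
rewrite (@eq_mean _ _ _ _ _ (fun x => Dfun l n (dot eta x))); last first.
  by move=> x _; rewrite mul0r expR0 mul1r.
by rewrite mean_Dfun// mul0r normr0.
Qed.

(** The mixing weights [g] stay abstract so that [psk] and [gpsk] are served at once; they are
    prescribed from index 1 on only, as the formula for [psk] has no counterpart at 0. *)
Lemma MF_mixture eta rho b (g : nat -> R) A : (0 < d)%N ->
  is_uniform_on_sphere sigma -> on_sphere eta -> 0 < rho -> measurable A ->
  b = expR rho / c0 rho - 1 -> b != 0 ->
  (forall n, b * g n.+1 = weight l n.+1 * hcoef l n.+1 rho / c0 rho) ->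
  (MF sigma eta rho A = (1 - b)%:E * sigma A
     + b%:E * \sum_(1 <= n <oo) (g n)%:E * Delta sigma l n eta A)%E.
Proof.
move=> d0 us Se r0 mA bE b0 gE; have l0 := @lambda_ge0 R d d0.
have h0 := hcoef0_gt0 d0 us Se (ltW r0).
pose m1 := mean sigma A (fun=> 1).
pose mD n := mean sigma A (fun x => Dfun l n (dot eta x)).
pose mE := mean sigma A (fun x => expR (rho * dot eta x)).
have sA : sigma A = m1%:E.
  by rewrite -integral_tame ?integral_cst ?mul1e//; exact: tame_cst.
have DA n : Delta sigma l n eta A = (m1 + mD n)%:E.
  rewrite /Delta /with_density.
  under eq_integral do rewrite DpolyE//.
  rewrite integral_tame//; last by apply: tameD; [exact: tame_cst|exact: tame_Dfun_dot].
  by rewrite meanD//; [exact: tame_cst|exact: tame_Dfun_dot].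
have MA : MF sigma eta rho A = (mE / c0 rho)%:E.
  rewrite /MF /with_density; under eq_integral do rewrite mf_profileE//.
  rewrite integral_tame//; last by apply: tameZ; exact: tame_expR_dot.
  by rewrite meanZ 1?mulrC//; exact: tame_expR_dot.
(* The mixture series completed by a term of index 0, so that the convergence results for sums from
   0 apply. *)
pose u n := weight l n * hcoef l n rho / c0 rho / b * (m1 + mD n).
have ucv : \sum_(n < N) u n @[N --> \oo] --> (expR rho * m1 + mE) / (c0 rho * b).
  have := @mean_expR_cvg eta A (fun=> 1) rho 1 d0 us Se (ltW r0) mA (tame_cst 1) ler01.
  have n1 (x : euclidean R d) : on_sphere x -> `|1 : R| <= 1 by rewrite normr1.
  move=> /(_ n1) cE.
  have -> : (fun N => \sum_(n < N) u n) = (fun N =>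
     ((\sum_(n < N) weight l n * hcoef l n rho) * m1 +
      \sum_(n < N) weight l n * hcoef l n rho *
       mean sigma A (fun x => Dfun l n (dot eta x) * 1)) / (c0 rho * b)).
    apply: funext => N; rewrite !mulr_suml -big_split mulr_suml.
    apply: eq_bigr => n _; rewrite /u.
    have -> : mean sigma A (fun x => Dfun l n (dot eta x) * 1) = mD n.
      by apply: eq_mean => x _; rewrite mulr1.
    by rewrite /= invfM; ring.
  have -> : mE = mean sigma A (fun x => expR (rho * dot eta x) * 1).
    by apply: eq_mean => x _; rewrite mulr1.
  apply: cvgM; last exact: cvg_cst.
  apply: cvgD => //; apply: cvgM; last exact: cvg_cst.
  by apply: hcoef_sum => //; exact: ltW.
have -> : (\sum_(1 <= n <oo) (g n)%:E * Delta sigma l n eta A =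
    ((expR rho * m1 + mE) / (c0 rho * b) - u 0)%:E)%E.
  rewrite -(eseries_from1 ucv); congr (limn _); apply: funext => N.
  apply: eq_big_nat => n /andP[n1 _].
  rewrite DA -EFinM; congr EFin; rewrite /u; congr (_ * _).
  by case: n n1 => // n _; rewrite -gE mulrAC divff// mul1r.
rewrite sA MA -!EFinM -EFinD; congr EFin.
(* The factor 2 is the density [1 + D_0] that index 0 would carry. *)
have u0 : u 0 = 2 * m1 / b.
  rewrite /u weight0 mul1r divff ?gt_eqF//.
  have -> : mD 0 = m1 by apply: eq_mean.
  by rewrite mul1r mulrC; congr (_ * _); ring.
rewrite u0.
have -> : expR rho = (b + 1) * c0 rho by rewrite bE subrK divfK// gt_eqF.
by field; rewrite b0 gt_eqF.
Qed.

End von_Mises_Fisher.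

(** * Existence and uniqueness of the critical concentration *)

Section critical_concentration.
Context {R : realType} {d : nat}.
Variable sigma : probability (euclidean R d) R.
Implicit Types (eta : euclidean R d) (rho a b : R).

Local Notation l := (lambda R d).

(** For [rho > 0] this is [1 / (beta + 1)], so [beta = 1] becomes the value 1/2. *)
Definition excess_ratio rho : R := hcoef l 0 rho / expR rho.

Lemma basis_on_sphere i : on_sphere (@basis_vec R d i).
Proof. by apply/on_sphereE; rewrite dot_basis2 eqxx. Qed.

Lemma tame_expRB eta rho : tame (fun x => expR (rho * (dot eta x - 1))).
Proof. by apply/tame_expR/tameZ/tameB; [exact: tame_dot|exact: tame_cst]. Qed.

Lemma excess_ratioE eta rho : (0 < d)%N -> is_uniform_on_sphere sigma ->
  on_sphere eta -> 0 <= rho ->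
  excess_ratio rho = mean sigma setT (fun x => expR (rho * (dot eta x - 1))).
Proof.
move=> d0 us Se r0; rewrite /excess_ratio -(mean_expR d0 us Se r0) mulrC -meanZ//.
  by apply: eq_mean => x _; rewrite -expRN -expRD; congr expR; ring.
exact: tame_expR_dot.
Qed.

Lemma mean_dot eta : is_uniform_on_sphere sigma -> mean sigma setT (dot eta) = 0.
Proof. by move=> us; rewrite -[RHS](@moment_odd R d sigma eta 1 us isT). Qed.

(** Strictness survives integration because the pointwise gap is at least [c (1 - t)] with
    [c = e^(-2b) (b - a)], and [1 - t] has mean 1. *)
Lemma excess_ratio_decr a b : (0 < d)%N -> is_uniform_on_sphere sigma ->
  0 <= a -> a < b -> excess_ratio b < excess_ratio a.
Proof.
move=> d0 us a0 ab; have b0 : 0 <= b by lra.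
have Se := basis_on_sphere ord0; set eta := basis_vec ord0 in Se.
rewrite !(excess_ratioE d0 us Se)//.
pose c := expR (- (2 * b)) * (b - a).
have c0 : 0 < c by rewrite mulr_gt0 ?expR_gt0 ?subr_gt0.
have ta := tame_expRB eta a; have tb := tame_expRB eta b.
have td : tame (fun x => 1 - dot eta x) by apply: tameB; [exact: tame_cst|exact: tame_dot].
rewrite -subr_gt0; apply: (lt_le_trans c0).
rewrite -[leLHS]mulr1 -[X in _ * X](subr0 1) -(mean_dot eta us) -[X in X - _](mean1 us).
rewrite -meanB ?tame_cst//; last 2 first.
- exact: tame_cst.
- exact: tame_dot.
rewrite -meanZ// -meanB//; apply: mean_le => //; [exact: tameZ|exact: tameB|].
move=> x Sx; have := dot_le1 Se Sx; rewrite ler_norml => /andP[t1 t2].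
set t := dot eta x in t1 t2 *.
have -> : expR (a * (t - 1)) = expR (b * (t - 1)) * expR ((b - a) * (1 - t)).
  by rewrite -expRD; congr expR; ring.
rewrite -[X in _ <= _ - X]mulr1 -mulrBr /c -mulrA ler_pM ?expR_ge0//.
- by rewrite mulr_ge0; lra.
- by rewrite ler_expR; nra.
- by rewrite lerBrDl expR_ge1Dx.
Qed.

(** Pointwise the gap is at most [1 - e^(-(b-a)(1-t)) <= (b - a)(1 - t)], and [1 - t <= 2]. *)
Lemma excess_ratio_lip a b : (0 < d)%N -> is_uniform_on_sphere sigma ->
  0 <= a -> a <= b -> excess_ratio a - excess_ratio b <= 2 * (b - a).
Proof.
move=> d0 us a0 ab; have b0 : 0 <= b by lra.
have Se := basis_on_sphere ord0; set eta := basis_vec ord0 in Se.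
rewrite !(excess_ratioE d0 us Se)//.
have ta := tame_expRB eta a; have tb := tame_expRB eta b.
rewrite -[leRHS]mulr1 -[X in _ <= _ * X](mean1 us) -meanZ//; last exact: tame_cst.
rewrite -meanB//; apply: mean_le => //; [exact: tameB|exact/tameZ/tame_cst|].
move=> x Sx; have := dot_le1 Se Sx; rewrite ler_norml => /andP[t1 t2].
set t := dot eta x in t1 t2 *.
have -> : expR (b * (t - 1)) = expR (a * (t - 1)) * expR ((b - a) * (t - 1)).
  by rewrite -expRD; congr expR; ring.
rewrite -[X in X - _ <= _]mulr1 -mulrBr mulr1.
have e1 : expR (a * (t - 1)) <= 1 by rewrite -[leRHS]expR0 ler_expR mulr_ge0_le0// subr_le0.
have e0 := expR_ge0 (a * (t - 1)).
have := expR_ge1Dx ((b - a) * (t - 1)).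
set y := expR ((b - a) * _) => y1.
have ys : 1 - y <= 2 * (b - a).
  have ab0 : 0 <= (b - a) * (t + 1) by rewrite mulr_ge0//; lra.
  lra.
have [y0|y0] := lerP 0 (1 - y).
  by apply: le_trans ys; rewrite -[leRHS]mul1r ler_wpM2r.
apply: (@le_trans _ _ 0); last by lra.
by rewrite mulr_ge0_le0// ltW.
Qed.

Lemma excess_ratio0 : (0 < d)%N -> is_uniform_on_sphere sigma -> excess_ratio 0 = 1.
Proof.
move=> d0 us; rewrite (excess_ratioE d0 us (basis_on_sphere ord0))// -(mean1 us).
by apply: eq_mean => x _; rewrite mul0r expR0.
Qed.

(* [exp (-56 s) <= (1 - s/2)^2 + 1/8] on [0, 2], and [(1 - s/2)^2 = ((1+t)/2)^2]
   has mean [(1 + 1/(d+1))/4 <= 3/8]. *)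
Lemma excess_ratio_le_half : (0 < d)%N -> is_uniform_on_sphere sigma ->
  excess_ratio 56 <= 1 / 2.
Proof.
move=> d0 us; have Se := basis_on_sphere ord0; set eta := basis_vec ord0 in Se.
rewrite (excess_ratioE d0 us Se)//.
have td := tame_dot eta; have td2 := tame_dotX eta 2.
have t1 := @tame_cst R d 1.
have m2 : moment sigma eta 2 <= 1 / 2.
  have := moment_rec 0 d0 us Se; rewrite moment0// mulr1 add0r => H.
  have D1 : 1 <= d%:R :> R by rewrite ler1n.
  have M0 : 0 <= moment sigma eta 2.
    rewrite -(mul0r (mean sigma setT (fun=> 1))) -meanZ//.
    apply: mean_le => //; [exact: tameZ|].
    by move=> x _; rewrite mul0r sqr_ge0.
  have : (1 + d%:R) * moment sigma eta 2 = 1 by rewrite H.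
  by move: (moment sigma eta 2) (d%:R : R) M0 D1 => M D M0 D1 {}H; nra.
apply: (@le_trans _ _ (3 / 8 * mean sigma setT (fun=> 1) +
   (1 / 2 * mean sigma setT (dot eta) + 1 / 4 * moment sigma eta 2))).
  rewrite /moment -!meanZ// -!meanD//; try exact: tameZ; last first.
    by apply: tameD; exact: tameZ.
  apply: mean_le => //; first exact: tame_expRB.
    by apply: tameD; [exact: tameZ|apply: tameD; exact: tameZ].
  move=> x Sx; have := dot_le1 Se Sx; rewrite ler_norml => /andP[x1 x2].
  set t := dot eta x in x1 x2 *.
  (* The constant is [56 = 7 * 8]: for [t < 7/8] the exponent is below -7, and [e^7 >= 1 + 7]. For
     [t >= 7/8] the trivial bound 1 is already below [((1+t)/2)^2 + 1/8]. *)
  have [ht|ht] := lerP (7 / 8) t.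
    have : expR (56 * (t - 1)) <= 1 by rewrite -[leRHS]expR0 ler_expR; lra.
    by nra.
  have : expR (56 * (t - 1)) <= 1 / 8.
    rewrite -[56 * (t - 1)]opprK expRN div1r lef_pV2 ?posrE ?expR_gt0//.
    by apply: le_trans (expR_ge1Dx _); lra.
  by nra.
by rewrite (mean1 us) mean_dot//; lra.
Qed.

Lemma excess_ratio_root : (0 < d)%N -> is_uniform_on_sphere sigma ->
  exists2 rho0, 0 < rho0 & excess_ratio rho0 = 1 / 2.
Proof.
(* The even extension is Lipschitz on the whole line, which avoids one-sided continuity at 0. *)
move=> d0 us; pose G (a : R) := excess_ratio `|a|.
have GL a b : `|G a - G b| <= 2 * `|a - b|.
  wlog ab : a b / `|a| <= `|b|.
    move=> H; have [/H//|/ltW/H] := lerP `|a| `|b|.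
    by rewrite distrC [`|b - a|]distrC.
  have L := excess_ratio_lip d0 us (normr_ge0 a) ab.
  have L0 : excess_ratio `|b| <= excess_ratio `|a|.
    move: ab; rewrite le_eqVlt => /predU1P[->//|ab].
    by apply/ltW/excess_ratio_decr.
  rewrite ger0_norm ?subr_ge0//; apply: (le_trans L).
  by rewrite ler_wpM2l// distrC lerB_dist.
have cG : continuous G.
  move=> a; apply/cvgrPdist_le => e e0; near=> b.
  apply: (le_trans (GL a b)); rewrite -ler_pdivlMl//.
  by near: b; apply: cvgr_dist_le => //; rewrite mulr_gt0 ?invr_gt0.
have G0 : G 0 = 1 by rewrite /G normr0 excess_ratio0.
have G56 : G 56 <= 1 / 2 by rewrite /G ger0_norm// excess_ratio_le_half.
have := @IVT R G 0 56 (1 / 2) (ler0n _ _) (continuous_subspaceT cG).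
rewrite G0 minElt maxElt.
have -> : (1 < G 56) = false by lra.
rewrite G56 /= => /(_ ltac:(lra))[c].
rewrite in_itv/= => /andP[c0 _] Gc.
exists c; last by rewrite -Gc /G ger0_norm.
rewrite lt_neqAle c0 andbT; apply/eqP => c00.
by move: Gc; rewrite -c00 G0; lra.
Unshelve. all: by end_near. Qed.

Lemma excess_ratio_inj a b : (0 < d)%N -> is_uniform_on_sphere sigma ->
  0 <= a -> 0 <= b -> excess_ratio a = excess_ratio b -> a = b.
Proof.
move=> d0 us a0 b0 ab; have [h|h|//] := ltgtP a b.
  by have := excess_ratio_decr d0 us a0 h; rewrite ab ltxx.
by have := excess_ratio_decr d0 us b0 h; rewrite ab ltxx.
Qed.

Lemma beta_eq1 rho : (0 < d)%N -> is_uniform_on_sphere sigma -> 0 < rho ->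
  expR rho / hcoef l 0 rho - 1 = 1 <-> excess_ratio rho = 1 / 2.
Proof.
move=> d0 us r0; have h0 := hcoef0_gt0 d0 us (basis_on_sphere ord0) (ltW r0).
have e0 := expR_gt0 rho; rewrite /excess_ratio -[expR rho / _]invf_div.
have q0 : 0 < hcoef l 0 rho / expR rho by rewrite divr_gt0.
move: (hcoef l 0 rho / expR rho) q0 => q q0; split => h.
  have : q^-1 = 2 by lra.
  by move=> <-; rewrite div1r invrK.
by rewrite h; lra.
Qed.

Lemma beta_gt0 rho : (0 < d)%N -> is_uniform_on_sphere sigma -> 0 < rho ->
  0 < expR rho / hcoef l 0 rho - 1.
Proof.
move=> d0 us r0; have h0 := hcoef0_gt0 d0 us (basis_on_sphere ord0) (ltW r0).
have := excess_ratio_decr d0 us (lexx 0) r0; rewrite excess_ratio0//.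
by rewrite /excess_ratio subr_gt0 ltr_pdivrMr ?expR_gt0// mul1r ltr_pdivlMr// mul1r.
Qed.

End critical_concentration.

(** * Numerical location of the critical concentration for the circle *)

Section numerics.
Context {R : realType}.
Implicit Types (a q x : R) (k j K N : nat).

(** Comparison with a geometric series: successive terms have ratio at most [x], so adding
    [exp_coeff x K / (1 - x)] to the partial tail gives a nonincreasing quantity in [K]. *)
Lemma exp_tail_le x N : 0 <= x -> x < 1 ->
  exp_tail x N <= exp_coeff x N / (1 - x).
Proof.
move=> x0 x1; have y0 : 0 < 1 - x by lra.
have step K : (N <= K)%N ->
    series (exp_coeff x) K - series (exp_coeff x) N + exp_coeff x K / (1 - x) <=
    exp_coeff x N / (1 - x).
  move=> NK; rewrite -(subnKC NK); elim: (K - N)%N => [|i IH].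
    by rewrite addn0 subrr add0r.
  apply: le_trans IH; rewrite addnS seriesSr -addrA -!addrA lerD2l addrCA lerD2l.
  set m := (N + i)%N; rewrite /exp_coeff /= exprS factS natrM.
  have f0 : 0 < m`!%:R :> R by rewrite ltr0n fact_gt0.
  have m1 : 1 <= m.+1%:R :> R by rewrite ler1n.
  have z0 : 0 <= x ^+ m / m`!%:R by apply: divr_ge0; [exact: exprn_ge0|exact: ltW].
  have -> : x * x ^+ m / (m.+1%:R * m`!%:R) / (1 - x) =
      x ^+ m / m`!%:R * (x / m.+1%:R / (1 - x)).
    move: (m.+1%:R : R) m1 => M M1.
    by field; rewrite !gt_eqF//=; lra.
  rewrite -[X in X + _ <= _]mulr1 -mulrDr ler_wpM2l// -[leRHS]div1r ler_pdivlMr//.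
  rewrite mulrDl mul1r divfK ?gt_eqF//.
  have : x / m.+1%:R <= x by rewrite ler_pdivrMr ?(lt_le_trans ltr01 m1)// ler_peMr.
  by move: (x / m.+1%:R) => y hy; lra.
have cl : series (exp_coeff x) K - series (exp_coeff x) N @[K --> \oo] --> exp_tail x N.
  by apply: cvgB; [exact: cvg_exp_series|exact: cvg_cst].
apply: (ler_cvg_to cl (cvg_cst (exp_coeff x N / (1 - x)))); near=> K.
have NK : (N <= K)%N by near: K; exact: nbhs_infty_ge.
apply: le_trans (step K NK); rewrite lerDl divr_ge0 ?exp_coeff_ge0//; exact: ltW.
Unshelve. all: by end_near. Qed.

(** The coefficients lie between 0 and [1/k!], so the exponential tail dominates the remainder. *)
Lemma hcoef0_bounds l x N : 0 <= l -> 0 <= x ->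
  series (fun k => mcoef l k 0 * x ^+ k) N <= hcoef l 0 x
  <= series (fun k => mcoef l k 0 * x ^+ k) N + exp_tail x N.
Proof.
move=> l0 x0; have cv := @cvg_hcoef R l 0 x l0 x0.
have t0 k : 0 <= mcoef l k 0 * x ^+ k by rewrite mulr_ge0 ?mcoef_ge0 ?exprn_ge0.
apply/andP; split.
  apply: (ler_cvg_to (cvg_cst (series (fun k => mcoef l k 0 * x ^+ k) N)) cv); near=> K.
  have NK : (N <= K)%N by near: K; exact: nbhs_infty_ge.
  by rewrite -subr_ge0 sub_series_geq// sumr_ge0.
rewrite -lerBlDl.
have cl : series (fun k => mcoef l k 0 * x ^+ k) K - series (fun k => mcoef l k 0 * x ^+ k) N
    @[K --> \oo] --> hcoef l 0 x - series (fun k => mcoef l k 0 * x ^+ k) N.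
  by apply: cvgB; [exact: cv|exact: cvg_cst].
have cr : series (exp_coeff x) K - series (exp_coeff x) N @[K --> \oo] --> exp_tail x N.
  by apply: cvgB; [exact: cvg_exp_series|exact: cvg_cst].
apply: (ler_cvg_to cl cr); near=> K.
have NK : (N <= K)%N by near: K; exact: nbhs_infty_ge.
rewrite !sub_series_geq// ler_sum// => k _; rewrite /exp_coeff /= mulrC ler_wpM2l ?exprn_ge0//.
by have := weight_mcoef_le k 0 l0; rewrite weight0 mul1r.
Unshelve. all: by end_near. Qed.

Lemma exp_coeffS x k : exp_coeff x k.+1 = exp_coeff x k * (x / k.+1%:R).
Proof.
rewrite /exp_coeff /= exprS factS natrM.
have f0 : k`!%:R != 0 :> R by rewrite pnatr_eq0 -lt0n fact_gt0.
have m0 : k.+1%:R != 0 :> R by rewrite pnatr_eq0.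
move: (k.+1%:R : R) m0 => M M0.
by field; rewrite f0 M0.
Qed.

Lemma exp_coeff0 x : exp_coeff x 0 = 1.
Proof. by rewrite /exp_coeff /= expr0 fact0 divr1. Qed.

Definition bessel_term x j : R := bcoef 0 j 0 * x ^+ j.*2.

Lemma bessel_term0 x : bessel_term x 0 = 1.
Proof. by rewrite /bessel_term /bcoef /rising big_ord0 fact0 !mulr1 invr1. Qed.

Lemma bessel_termS x j :
  bessel_term x j.+1 = bessel_term x j * (x ^+ 2 / 4 / (j.+1%:R * j.+1%:R)).
Proof.
rewrite /bessel_term /bcoef !add0n doubleS !exprS factS natrM risingS add0r.
have -> : 1 + j%:R = j.+1%:R :> R by rewrite addrC natr1.
have f0 : j`!%:R != 0 :> R by rewrite pnatr_eq0 -lt0n fact_gt0.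
have r0 := rising_gt0 j (lexx (0 : R)).
have m0 : j.+1%:R != 0 :> R by rewrite pnatr_eq0.
move: (j.+1%:R : R) m0 => M M0.
by field; rewrite M0 f0 expf_neq0 ?gt_eqF.
Qed.

(** The six terms of [I_0(x)] of degree below 12 in Horner form, with [q = x^2 / 4]. *)
Definition bessel_poly q : R := 1 + q * (1 + q / 4 * (1 + q / 9 * (1 + q / 16 * (1 + q / 25)))).

(* The last factor [r] stands for the tail: [r = 0] truncates the series, and
   [r = 9] dominates it for [x <= 8/9], where [1 / (1 - x) <= 9]. *)
Definition exp_poly x r : R :=
  1 + x * (1 + x / 2 * (1 + x / 3 * (1 + x / 4 * (1 + x / 5 * (1 + x / 6 * (1 + x / 7 *
  (1 + x / 8 * (1 + x / 9 * (1 + x / 10 * (1 + x / 11 * (1 + x / 12 * r))))))))))).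

Lemma bessel_polyE x :
  series (fun k => mcoef 0 k 0 * x ^+ k) 12 = bessel_poly (x ^+ 2 / 4).
Proof.
rewrite (@series_hcoef_subseq R 0 0 x 6) seriesEnat /=.
rewrite (eq_bigr (bessel_term x))//.
rewrite !big_nat_recr//= big_geq// !bessel_termS bessel_term0 /bessel_poly.
by field.
Qed.

Lemma series_horner12 (E c : nat -> R) r : E 0 = 1 ->
  (forall k, E k.+1 = E k * c k) -> series E 12 + E 12 * r =
  1 + c 0 * (1 + c 1 * (1 + c 2 * (1 + c 3 * (1 + c 4 * (1 + c 5 * (1 + c 6 *
  (1 + c 7 * (1 + c 8 * (1 + c 9 * (1 + c 10 * (1 + c 11 * r))))))))))).
Proof.
move=> E0 ES; rewrite !seriesSr !ES E0 seriesEnat /= big_geq//.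
move: (c 0) (c 1) (c 2) (c 3) (c 4) (c 5) (c 6) (c 7) (c 8) (c 9) (c 10) (c 11).
by move=> c0 c1 c2 c3 c4 c5 c6 c7 c8 c9 c10 c11; ring.
Qed.

Lemma exp_polyE x (r : R) :
  series (exp_coeff x) 12 + exp_coeff x 12 * r = exp_poly x r.
Proof. by rewrite (series_horner12 r (exp_coeff0 x) (exp_coeffS x)) divr1. Qed.

Lemma numeric_bounds x : 0 <= x -> x <= 8 / 9 ->
  exp_poly x 0 <= expR x <= exp_poly x 9 /\
  bessel_poly (x ^+ 2 / 4) <= hcoef 0 0 x
  <= bessel_poly (x ^+ 2 / 4) + (expR x - exp_poly x 0).
Proof.
move=> x0 x1; have x2 : x < 1 by lra.
have := @hcoef0_bounds 0 x 12 (lexx _) x0; rewrite bessel_polyE.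
have := exp_polyE x 0; have := exp_polyE x 9.
have := @exp_tail_le x 12 x0 x2; have := @exp_coeff_ge0 R x 12 x0.
have i9 : (1 - x)^-1 <= 9.
  by rewrite -[leRHS]invrK lef_pV2 ?posrE ?invr_gt0//; lra.
have : 0 <= exp_tail x 12.
  rewrite subr_ge0; apply: (ler_cvg_to (cvg_cst _) (@cvg_exp_series R x)).
  near=> K; have NK : (12 <= K)%N by near: K; exact: nbhs_infty_ge.
  by rewrite -subr_ge0 sub_series_geq// sumr_ge0// => k _; exact: exp_coeff_ge0.
rewrite /exp_tail; move: (series (exp_coeff x) 12) (exp_coeff x 12) (exp_poly x 0)
  (exp_poly x 9) => T E P0 P9 h0 hE hT h9 h1 hb.
have t9 : E / (1 - x) <= E * 9 by rewrite ler_wpM2l.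
move: hb; rewrite -h1 -h9 mulr0 addr0 => /andP[hb1 hb2].
by split; apply/andP; split; lra.
Unshelve. all: by end_near. Qed.

Lemma lambda1 : lambda R 1 = 0.
Proof. by rewrite /lambda subrr mul0r. Qed.

Lemma critical_concentration1 (sigma : probability (euclidean R 1) R) rho :
  is_uniform_on_sphere sigma -> 0 < rho -> @excess_ratio R 1 rho = 1 / 2 ->
  `|rho - (876 / 10 ^+ 3 + 842 / 10 ^+ 6)| < 5 / 10 ^+ 7.
Proof.
move=> us r0 rE.
(* The ends [a] and [b] are 0.876842 minus and plus half a unit of the sixth decimal. The ratio is
   above 1/2 at [a] and below it at [b], and monotonicity traps the root. *)
pose a : R := 876 / 10 ^+ 3 + 841 / 10 ^+ 6 + 5 / 10 ^+ 7.
pose b : R := 876 / 10 ^+ 3 + 842 / 10 ^+ 6 + 5 / 10 ^+ 7.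
have a0 : 0 <= a by rewrite /a; lra.
have b0 : 0 <= b by rewrite /b; lra.
have a1 : a <= 8 / 9 by rewrite /a; lra.
have b1 : b <= 8 / 9 by rewrite /b; lra.
have [/andP[_ ea] /andP[ba _]] := numeric_bounds a0 a1.
have na : exp_poly a 9 < 2 * bessel_poly (a ^+ 2 / 4).
  by rewrite /exp_poly /bessel_poly /a; lra.
have [/andP[eb eb'] /andP[_ bb]] := numeric_bounds b0 b1.
(* With [e = expR b], [h = hcoef 0 0 b], [q] the Bessel polynomial and [P_0, P_9] the exponential
   ones: [2 h <= 2 q + 2 (e - P_0)] and [e <= P_9], so [2 q + P_9 < 2 P_0] yields [2 h < e]. *)
have nb : 2 * bessel_poly (b ^+ 2 / 4) + (exp_poly b 9 - exp_poly b 0) < exp_poly b 0.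
  by rewrite /exp_poly /bessel_poly /b; lra.
have ha : expR a < 2 * hcoef 0 0 a.
  by apply: (le_lt_trans ea); apply: (lt_le_trans na); rewrite ler_pM2l.
have hb : 2 * hcoef 0 0 b < expR b.
  move: (expR b) (hcoef 0 0 b) (exp_poly b 9) (exp_poly b 0)
    (bessel_poly (b ^+ 2 / 4)) eb eb' bb nb.
  by clear; move=> e h p9 p0 q *; lra.
have ra : 1 / 2 < @excess_ratio R 1 a.
  by rewrite /excess_ratio lambda1 ltr_pdivlMr ?expR_gt0//; lra.
have rb : @excess_ratio R 1 b < 1 / 2.
  by rewrite /excess_ratio lambda1 ltr_pdivrMr ?expR_gt0//; lra.
have ar : a < rho.
  rewrite ltNge le_eqVlt; apply/negP => /predU1P[E|ra'].
    by move: ra; rewrite -E rE ltxx.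
  have := excess_ratio_decr (ltn0Sn 0) us (ltW r0) ra'.
  by rewrite rE => /(lt_trans ra); rewrite ltxx.
have br : rho < b.
  rewrite ltNge le_eqVlt; apply/negP => /predU1P[E|rb'].
    by move: rb; rewrite E rE ltxx.
  have := excess_ratio_decr (ltn0Sn 0) us b0 rb'.
  by rewrite rE => /lt_trans/(_ rb); rewrite ltxx.
by move: ar br; rewrite /a /b ltr_norml; lra.
Qed.

End numerics.

(** * Matching the Skellam weights with the expansion coefficients *)

Section mixing_weights.
Context {R : realType}.
Implicit Types (rho : R) (n : nat).

Lemma besselI_hcoef0 n rho : 0 < rho -> besselI n%:R rho = hcoef 0 n rho.
Proof.
move=> r0; have := besselI_hcoef n (lexx (0 : R)) r0.
by rewrite !add0r Gamma1 powRr0 divr1 mul1r.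
Qed.

(** By the convention [powR 0 0 = 1] the leading term survives and all others vanish. This makes the
    formula for [beta] on the circle valid at [rho = 0]. *)
Lemma besselI00 : besselI 0 0 = 1 :> R.
Proof.
apply/cvg_lim => //; rewrite -(cvg_shiftS _).
apply: cvg_near_cst; apply: nearW => N.
rewrite seriesEnat /= big_nat_recl//= big1_seq => [|n _]; last first.
  by rewrite mul0r powR0 ?mulr0// addr0 mulf_neq0// pnatr_eq0.
by rewrite mulr0 !addr0 powRr0 fact0 add0r Gamma1 !mulr1 invr1.
Qed.

(** Writing [b] for the first factor, the denominator of [psk] is [b * hcoef 0 0 rho / e^rho], so
    [b] and the exponential cancel. *)
Lemma psk_weight rho n : 0 < rho -> expR rho / hcoef 0 0 rho - 1 != 0 ->
  hcoef 0 0 rho != 0 ->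
  (expR rho / hcoef 0 0 rho - 1) * psk n.+1 rho =
  weight 0 n.+1 * hcoef 0 n.+1 rho / hcoef 0 0 rho.
Proof.
move=> r0 b0 h0; rewrite /psk weight_chebyshev besselI_hcoef0//.
have -> : besselI 0 rho = hcoef 0 0 rho by rewrite -(besselI_hcoef0 0 r0).
have e0 : expR rho != 0 by rewrite gt_eqF ?expR_gt0.
rewrite expRN; move: (expR rho) (hcoef 0 0 rho) b0 h0 e0 => e h b0 h0 e0.
have eh : e - h != 0.
  by apply: contra b0; rewrite !subr_eq0 => /eqP ->; rewrite divff.
by field; rewrite h0 e0 eh.
Qed.

Lemma beta_lamE d rho : (0 < d)%N -> 0 < rho ->
  beta_lam (lambda R d) rho = expR rho / hcoef (lambda R d) 0 rho - 1.
Proof.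
move=> d0 r0; rewrite /beta_lam gt_eqF// bessel_normalization//.
have p0 : rho `^ lambda R d != 0 by rewrite gt_eqF// powR_gt0.
by rewrite -mulf_div divff// mul1r.
Qed.

(** The local quantity [q] of [gpsk] equals [hcoef l 0 rho / e^rho = 1 / (b + 1)], where [b] is the
    first factor; hence [q / (1 - q) = 1 / b]. *)
Lemma gpsk_weight d rho n : (1 < d)%N -> 0 < rho ->
  let l := lambda R d in
  expR rho / hcoef l 0 rho - 1 != 0 -> hcoef l 0 rho != 0 ->
  (expR rho / hcoef l 0 rho - 1) * gpsk n l rho =
  weight l n * hcoef l n rho / hcoef l 0 rho.
Proof.
move=> d1 r0 /=; have d0 := ltnW d1; have n0 := @bessel_normalization R d rho d0 r0.
have l1 : 1 <= 2 * lambda R d.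
  have -> : 2 * lambda R d = d%:R - 1 by rewrite /lambda; field.
  by rewrite lerBrDr -[1 + 1]/(2%:R) ler_nat.
move: (lambda R d) l1 n0 => l l1 n0.
have l0 : 0 < l by lra.
move=> b0 h0; rewrite /gpsk pochhammerE// -weight_gegenbauer//.
have p0 : rho `^ l != 0 by rewrite gt_eqF// powR_gt0.
have q0 : (rho / 2) `^ l != 0 by rewrite gt_eqF// powR_gt0//; lra.
have G0 : Gamma (l + 1) != 0 by apply/lt0r_neq0/Gamma_gt0; lra.
have e0 : expR rho != 0 by rewrite gt_eqF ?expR_gt0.
have -> : 2 `^ l * Gamma (l + 1) * rho `^ (- l) * expR (- rho) * besselI l rho =
    hcoef l 0 rho / expR rho.
  rewrite powRN expRN.
  transitivity ((2 `^ l * Gamma (l + 1) * besselI l rho) / rho `^ l / expR rho).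
    by ring.
  by rewrite n0; field; rewrite p0 e0.
have -> : besselI (l + n%:R) rho / besselI l rho = hcoef l n rho / hcoef l 0 rho.
  have := besselI_hcoef 0 (ltW l0) r0; rewrite addr0 => ->.
  rewrite besselI_hcoef 1?ltW//.
  by field; rewrite h0 q0 G0.
move: (expR rho) (hcoef l 0 rho) b0 h0 e0 => e h b0 h0 e0.
have eh : e - h != 0.
  by apply: contra b0; rewrite !subr_eq0 => /eqP ->; rewrite divff.
by field; rewrite h0 e0 eh.
Qed.

Lemma MF_rho0 d (sigma : probability (euclidean R d) R) eta A :
  measurable A -> MF sigma eta 0 A = sigma A.
Proof.
move=> mA; rewrite /MF /with_density.
under eq_integral do rewrite /mf_profile eqxx.
by rewrite integral_cst// mul1e.
Qed.

End mixing_weights.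
Theorem theorem9 (R : realType) :
  (forall sigma : probability (euclidean R 1) R, is_uniform_on_sphere sigma ->
    (forall (eta : euclidean R 1) (rho : R), on_sphere eta -> 0 <= rho ->
       beta sigma eta (mf_profile 1 rho)
       = (expR rho / besselI 0 rho - 1)%:E) /\
    exists rho0 : R,
      [/\ 0 < rho0,
          forall (eta : euclidean R 1) (rho : R), on_sphere eta -> 0 < rho ->
            (beta sigma eta (mf_profile 1 rho) = 1%E <-> rho = rho0),
          `|rho0 - (876 / 10 ^+ 3 + 842 / 10 ^+ 6)| < 5 / 10 ^+ 7
        & forall (eta : euclidean R 1) (rho : R) (A : set (euclidean R 1)),
            on_sphere eta -> 0 <= rho <= rho0 -> measurable A ->
            let b := beta sigma eta (mf_profile 1 rho) in
            (MF sigma eta rho A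
             = (1 - b) * sigma A
               + b * \sum_(1 <= n <oo) (psk n rho)%:E * Delta sigma 0 n eta A)%E])
  /\
  (forall (d : nat) (sigma : probability (euclidean R d) R), (1 < d)%N ->
    is_uniform_on_sphere sigma ->
    let lam : R := lambda R d in
    (forall (eta : euclidean R d) (rho : R), on_sphere eta -> 0 <= rho ->
       beta sigma eta (mf_profile d rho) = (beta_lam lam rho)%:E) /\
    exists rho0 : R,
      [/\ 0 < rho0,
          forall rho : R, 0 < rho -> (beta_lam lam rho = 1 <-> rho = rho0)
        & forall (eta : euclidean R d) (rho : R) (A : set (euclidean R d)),
            on_sphere eta -> 0 <= rho <= rho0 -> measurable A ->
            (MF sigma eta rho A
             = (1 - beta_lam lam rho)%:E * sigma A
               + (beta_lam lam rho)%:E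
                 * \sum_(1 <= n <oo)
                     (gpsk n lam rho)%:E * Delta sigma lam n eta A)%E]).
Proof.
split=> [sigma us|d sigma d1 us lam].
  have d0 : (0 < 1)%N by [].
  have betaE (eta : euclidean R 1) (rho : R) : on_sphere eta -> 0 < rho ->
      beta sigma eta (mf_profile 1 rho) = (expR rho / hcoef 0 0 rho - 1)%:E.
    by move=> Se r0; rewrite beta_mf// lambda1.
  split.
    move=> eta rho Se; rewrite le_eqVlt => /predU1P[<-|r0].
      by rewrite beta_mf0// besselI00 expR0 divr1 subrr.
    by rewrite betaE// -(besselI_hcoef0 0 r0).
  have [rho0 r00 root] := excess_ratio_root d0 us.
  exists rho0; split=> //.
  - move=> eta rho Se r0; rewrite betaE//.
    have := beta_eq1 d0 us r0; rewrite lambda1 => eq1.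
    split=> [[/eq1 rE]|->].
      by apply: (excess_ratio_inj d0 us (ltW r0) (ltW r00)); rewrite rE.
    by have := beta_eq1 d0 us r00; rewrite lambda1 => -[_ ->].
  - exact: critical_concentration1 us r00 root.
  - move=> eta rho A Se /andP[+ _] mA b; rewrite /b le_eqVlt => /predU1P[<-|r0].
      (* At [rho = 0] the coefficient of the series is 0, and 0 times any extended real is 0, in
         accordance with the convention. *)
      by rewrite beta_mf0// sube0 mul1e mul0e adde0 MF_rho0.
    rewrite betaE// -EFinB.
    have b0 := beta_gt0 d0 us r0.
    have h0 := hcoef0_gt0 d0 us Se (ltW r0).
    have := @MF_mixture R 1 sigma eta rho _ (fun n => psk n rho) A d0 us Se r0 mA erefl.
    rewrite lambda1 in b0 h0 *; apply; first by rewrite gt_eqF.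
    by move=> n; apply: psk_weight => //; rewrite gt_eqF.
have d0 := ltnW d1; split.
  move=> eta rho Se; rewrite le_eqVlt => /predU1P[<-|r0].
    by rewrite beta_mf0// /beta_lam eqxx.
  by rewrite beta_mf// beta_lamE.
have [rho0 r00 root] := excess_ratio_root d0 us.
exists rho0; split=> //.
- move=> rho r0; rewrite beta_lamE//; split=> [/(beta_eq1 d0 us r0) rE|->].
    by apply: (excess_ratio_inj d0 us (ltW r0) (ltW r00)); rewrite rE.
  exact/(beta_eq1 d0 us r00).
- move=> eta rho A Se /andP[+ _] mA; rewrite le_eqVlt => /predU1P[<-|r0].
    by rewrite /beta_lam eqxx subr0 mul1e mul0e adde0 MF_rho0.
  have b0 := beta_gt0 d0 us r0; have h0 := hcoef0_gt0 d0 us Se (ltW r0).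
  apply: MF_mixture => //; first exact: beta_lamE.
    by rewrite beta_lamE// gt_eqF.
  by move=> n; rewrite beta_lamE//; apply: gpsk_weight => //; rewrite gt_eqF.
Qed.
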